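(* Let $X$ be a sock ordering that is not foot-sortable. Then some subpattern of $X$ belongs to $\Gamma$; that is, there is a subordering $Z\subseteq X$ that is equivalent to one of the sock orderings in the explicit list $\Gamma$ described in the context.
   Context: A sock ordering is a finite word of socks, each sock having a color; we write it as a word over colors, and in a displayed word distinct letters denote distinct colors. Two sock orderings $X=x_1\cdots x_n$ and $Z=z_1\cdots z_n$ are equivalent ($X\cong Z$) if there is a bijection $\varphi$ from the colors of $X$ to the colors of $Z$ with $\varphi(x_i)=z_i$ for all $i$. $Y\subseteq X$ ($Y$ is a subordering of $X$) if $Y$ is obtained from $X$ by deleting zero or more socks; $Y$ is a subpattern of $X$ ($Y\preceq X$) if $Z\cong Y$ for some $Z\subseteq X$. Foot-sorting: a state is a pair $(S,R)$, where $S$ is the content of a stack (read left to right = bottom to top) and $R$ is the remaining input. One step either pushes the leftmost sock of $R$ onto the top of the stack, or pops the top sock of the stack and appends it to the right end of the output. A state $(S,R)$ is foot-sortable if some sequence of steps reaches $(\emptyset,\emptyset)$ with an output in which all socks of each color are consecutive; otherwise it is unsortable. A sock ordering $X$ is foot-sortable iff $(\emptyset,X)$ is. For a sequence $(t_0,\dots,t_n)$ of distinct colors, $I(t_0)$ is the empty word and, for $n\ge1$, $I(t_0,\dots,t_n)=I(t_0,\dots,t_{n-1})\,t_nt_{n-1}=t_1t_0t_2t_1\cdots t_nt_{n-1}$. $\Gamma$ is the set of all sock orderings equivalent to one of the following: (i) $abacaba$, $abacbab$, $abcabca$, $abcacba$, $abcabac$, $abcbacb$, $abcbabc$, $abcadcab$,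 $abacdcba$, $abacdcab$; (ii) $datdarat$, $atdtarat$, $atdatrat$, $adtdarat$, $atdedarat$, $atdtrart$, $datdrart$, $adtdrart$, $atdedrart$, $atdtarbrt$, $adtdarbrt$, $datdarbrt$, $atdedarbrt$; (iii) $abtdatab$, $abtdtatb$, $adbtdabt$, $adbtdatb$, $abdtdatb$, $abtdedabt$, $abtdedatb$; (iv) for every $n\ge 0$ and distinct colors $a,b,d,e,t_0,\dots,t_n$, with $t=t_0$ and $E=I(t_0,\dots,t_n)\,a\,t_n$ (so $E=at_0$ when $n=0$): $I_{1,n}=dabtdE$, $I_{2,n}=adbtdbE$, $I_{3,n}=abdtdbE$, $I_{4,n}=abtdtbE$, $I_{5,n}=abtdedbE$. *)

(* Defs.v *)
From Stdlib Require Import Ascii String Relation_Operators.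
From mathcomp Require Import all_boot.

Set Implicit Arguments.
Unset Strict Implicit.
Unset Printing Implicit Defensive.

(* A sock ordering is a word [X : seq T] over a type of colors [T], and
   [subseq Z X] says that [Z] is a subordering of [X]. *)

(* Only the values of [phi] on the colors of [X] matter; [map phi X = Z] makes
   [phi] map the colors of [X] onto those of [Z]. *)
Definition equivalent (T U : eqType) (X : seq T) (Z : seq U) : Prop :=
  exists phi : T -> U, {in X &, injective phi} /\ map phi X = Z.

(* Stack (bottom to top), remaining input and output, all from left to right. *)
Definition config (T : Type) : Type := (seq T * seq T * seq T)%type.

Inductive step (T : Type) : config T -> config T -> Prop :=
| Push S x R O : step (S, x :: R, O) (rcons S x, R, O)
| Pop S x R O : step (rcons S x, R, O) (S, R, rcons O x).

Definition colors_consecutive (T : eqType) (O : seq T) : Prop :=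
  forall c s1 s2 s3, O = s1 ++ c :: s2 ++ c :: s3 -> all (pred1 c) s2.

Definition state_foot_sortable (T : eqType) (S R : seq T) : Prop :=
  exists2 O, clos_refl_trans (config T) (@step T) (S, R, [::]) ([::], [::], O)
           & colors_consecutive O.

Definition foot_sortable (T : eqType) (X : seq T) : Prop :=
  state_foot_sortable [::] X.

(* A displayed word: each letter is a color, encoded by its character code. *)
Definition word (s : string) : seq nat :=
  map nat_of_ascii (list_ascii_of_string s).

Definition Gamma_i : seq string :=
  [:: "abacaba"; "abacbab"; "abcabca"; "abcacba"; "abcabac"; "abcbacb";
      "abcbabc"; "abcadcab"; "abacdcba"; "abacdcab"]%string.

Definition Gamma_ii : seq string :=
  [:: "datdarat"; "atdtarat"; "atdatrat"; "adtdarat"; "atdedarat"; "atdtrart";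
      "datdrart"; "adtdrart"; "atdedrart"; "atdtarbrt"; "adtdarbrt";
      "datdarbrt"; "atdedarbrt"]%string.

Definition Gamma_iii : seq string :=
  [:: "abtdatab"; "abtdtatb"; "adbtdabt"; "adbtdatb"; "abdtdatb"; "abtdedabt";
      "abtdedatb"]%string.

(* [I_word t n] is I(t_0, ..., t_n). *)
Fixpoint I_word (C : Type) (t : nat -> C) (n : nat) : seq C :=
  if n is m.+1 then I_word t m ++ [:: t m.+1; t m] else [::].

Definition E_word (C : Type) (a : C) (t : nat -> C) (n : nat) : seq C :=
  I_word t n ++ [:: a; t n].

(* I_{1,n}, ..., I_{5,n} *)
Definition Gamma_iv (C : Type) (a b d e : C) (t : nat -> C) (n : nat) :
    seq (seq C) :=
  let t0 := t 0 in
  let E := E_word a t n in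
  [:: [:: d; a; b; t0; d] ++ E;
      [:: a; d; b; t0; d; b] ++ E;
      [:: a; b; d; t0; d; b] ++ E;
      [:: a; b; t0; d; t0; b] ++ E;
      [:: a; b; t0; d; e; d; b] ++ E].

(* The representatives are written over [nat], which has enough colors for
   every [n], whatever the type of colors of [Z]. *)
Definition Gamma (T : eqType) (Z : seq T) : Prop :=
  (exists2 s, s \in map word (Gamma_i ++ Gamma_ii ++ Gamma_iii)
            & equivalent Z s) \/
  (exists (n a b d e : nat) (t : nat -> nat),
     uniq ([:: a; b; d; e] ++ mkseq t n.+1) /\
     exists2 s, s \in Gamma_iv a b d e t n & equivalent Z s).

(* Main.v *)
Require Import Defs.
From Stdlib Require Import Relation_Operators.
From mathcomp Require Import all_boot.

(** As for stack-sortable permutations, [X] is foot-sortable as soon as its colors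
    can be ranked in such a way that no subsequence [u v w] of [X] has
    [w < u < v].  The same question makes sense for a state
    [(S, R)] whose stack must be decreasing, and the key is to determine the
    obstructions of states as well: besides the words of Gamma in [S R], they are
    the chains [a b t | I(t, t_1, ..., t_n) a t_n] and four short patterns.  That
    every state without obstruction is sortable follows by induction on its size.
    One color [z] is selected to be output next, essentially the one whose last
    sock comes first among the colors whose socks are not adjacent, or, when
    other colors alternate before that sock, the only color that can unlock
    them.  Outputting [z] leads to a smaller state, where the socks before the
    last [z] have joined the stack; if that state has an obstruction, then this
    obstruction and the socks that dictated the choice of [z] together contain an
    obstruction of [(S, R)].  Only finitely many configurations of bounded size
    arise, and they are checked by computation, except for the chains, which grow
    by one link or close up into a word of the infinite family. *)

Set Implicit Arguments.
Unset Strict Implicit.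
Unset Printing Implicit Defensive.

(** A chain transports one inequality. Write < for the output order. With [a b t] on the stack, t <
    b < a. If t_i < b, then t_{i+1} t_i in the input forces t_{i+1} < b, since otherwise b t_{i+1}
    t_i is a forbidden triple; at the end b a t_n is one. The number of links is not bounded, hence
    the infinite family. The five families of (iv) come from the place of the first sock of the
    output color [z]: before [a], between [a] and [b], between [b] and [t], or after [t] and
    followed by [t] or by a new color. The last four also use a sock of the separator [b] that is
    still to come. The obstacle is a dead chain, whose [b] has no sock after the last [z]: there the
    way in which [z] was selected must provide another separator, or a way to link the chain to the
    stack. A color whose socks are adjacent cannot always be output on arrival either: if [z h w]
    occurs and [h] has to stay, then w < z < h is forbidden. *)

Lemma subseq_catP (T : eqType) (s A B : seq T) :
  subseq s (A ++ B) ->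
  exists2 k, k <= size s & subseq (take k s) A && subseq (drop k s) B.
Proof.
elim: A s => [|a A IH] s; first by move=> sB; exists 0; rewrite ?take0 ?drop0.
case: s => [|x s] /=; first by exists 0 => //; rewrite sub0seq.
case: eqP => [->|_] /IH[k kS /andP[h1 h2]]; last first.
  exists k => //; rewrite h2 andbT.
  exact: subseq_trans h1 (subseq_cons _ _).
by exists k.+1 => //=; rewrite eqxx h1.
Qed.

Lemma index_ltn_subseq (T : eqType) (u w : T) L : u <> w ->
  index w L < index u L -> subseq [:: u; w] L -> subseq [:: w; u; w] L.
Proof.
move=> /eqP uw; elim: L => //= a L IH.
rewrite [w == a]eq_sym [u == a]eq_sym.
case: (eqVneq a w) => [->|aw]; first by rewrite eq_sym (negPf uw).
by case: (eqVneq a u) => [_|au] //; exact: IH.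
Qed.

(** * Ranks of colors as output orders *)

Section Rank.
Variable T : eqType.
Implicit Types (S R X : seq T) (r : T -> nat).

Definition no231 r X := forall u v w,
  subseq [:: u; v; w] X -> r w < r u -> r u < r v -> False.

Definition decreasing r S := forall u v,
  subseq [:: u; v] S -> u <> v -> r v < r u.

Definition sortable S R := exists r,
  [/\ {in S ++ R &, injective r}, decreasing r S & no231 r (S ++ R)].

(** Greedy rule: the next sock is pushed unless its rank exceeds that of the top, which is then
    popped. This pop is safe, because a later sock of smaller rank than the top would form a
    forbidden triple with the top and the next sock. The weight [(size R).*2 + size S] drops by one
    in each step. *)
Lemma stack_sort_run r n S R O :
    (size R).*2 + size S <= n ->
    pairwise (fun x y => r y <= r x) S -> pairwise (fun x y => r x <= r y) O ->
    allrel (fun x y => r x <= r y) O (S ++ R) -> no231 r (S ++ R) ->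
  exists O', [/\ clos_refl_trans _ (@step T) (S, R, O) ([::], [::], O'),
    pairwise (fun x y => r x <= r y) O' & {subset O' <= O ++ S ++ R}].
Proof.
elim: n S R O => [|n IH] S R O.
  case: R => [|//]; case: S => [|//] _ _ dO _ _.
  by exists O; split=> //; [exact: rt_refl | move=> x xO; rewrite !cats0].
have pop S' s : size R <> 0 \/ size S' < size S -> S = rcons S' s ->
    (size R).*2 + size S <= n.+1 ->
    pairwise (fun x y => r y <= r x) S -> pairwise (fun x y => r x <= r y) O ->
    allrel (fun x y => r x <= r y) O (S ++ R) -> no231 r (S ++ R) ->
    all (fun y => r s <= r y) R ->
    exists O', [/\ clos_refl_trans _ (@step T) (S, R, O) ([::], [::], O'),
      pairwise (fun x y => r x <= r y) O' & {subset O' <= O ++ S ++ R}].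
  move=> _ -> hn dS dO OSR n231 sR.
  have sub : subseq (S' ++ R) (rcons S' s ++ R).
    by rewrite cat_subseq // subseq_rcons.
  have [|||||O' [h1 h2 h3]] := IH S' R (rcons O s).
  - by move: hn; rewrite size_rcons addnS.
  - by move: dS; rewrite pairwise_rcons => /andP[].
  - rewrite pairwise_rcons dO andbT; apply/allP => o oO.
    move/allrelP: OSR; apply=> //.
    by rewrite mem_cat mem_rcons mem_head.
  - apply/allrelP => o y; rewrite mem_rcons inE => /orP[/eqP->|oO] hy.
      move: hy; rewrite mem_cat => /orP[yS|yR]; last exact: (allP sR).
      by move: dS; rewrite pairwise_rcons => /andP[/allP/(_ _ yS)].
    by move/allrelP: OSR; apply=> //; apply: (mem_subseq sub).
  - by move=> u v w h; apply: n231; apply: subseq_trans h sub.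
  exists O'; split=> //.
    by apply: rt_trans h1; apply: rt_step; exact: Pop.
  move=> x /h3; rewrite !mem_cat !mem_rcons !inE.
  by case: (x == s); case: (x \in O); case: (x \in S'); case: (x \in R).
case: R pop => [|x R] pop hn dS dO OSR n231.
  case/lastP: S => [|S s] in pop hn dS OSR n231 *.
    by exists O; split=> //; [exact: rt_refl | move=> x xO; rewrite !cats0].
  by apply: (pop S s) => //; right; rewrite size_rcons.
have push : pairwise (fun x y => r y <= r x) (rcons S x) ->
    exists O', [/\ clos_refl_trans _ (@step T) (S, x :: R, O) ([::], [::], O'),
      pairwise (fun x y => r x <= r y) O' & {subset O' <= O ++ S ++ x :: R}].
  move=> dSx; have [|||||O' [h1 h2 h3]] := IH (rcons S x) R O => //.
  - by move: hn; rewrite size_rcons /= doubleS !addSn addnS ltnS.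
  - by rewrite cat_rcons.
  - by rewrite cat_rcons.
  exists O'; split=> //; last by rewrite -cat_rcons.
  by apply: rt_trans h1; apply: rt_step; exact: Push.
case/lastP: S => [|S s] in pop push hn dS OSR n231 *; first exact: push.
have [sx|xs] := ltnP (r s) (r x); last first.
  apply: push; rewrite pairwise_rcons dS andbT.
  apply/allP => y; rewrite mem_rcons inE => /orP[/eqP->//|yS].
  apply: leq_trans xs _.
  by move: dS; rewrite pairwise_rcons => /andP[/allP/(_ _ yS)].
apply: (pop S s) => //; first by left.
rewrite /= (ltnW sx) /=; apply/allP => w wR; rewrite leqNgt; apply/negP => ws.
apply: (n231 s x w) => //; rewrite -cats1 -catA.
rewrite -[X in subseq X _]cat0s cat_subseq ?sub0seq //= !eqxx.
by rewrite sub1seq.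
Qed.

Lemma foot_sortable_rank X : sortable [::] X -> foot_sortable X.
Proof.
case=> r [/= rinj _ n231].
have [||||O [h1 h2 h3]] := @stack_sort_run r _ [::] X [::] (leqnn _) => //.
exists O => // c s1 s2 s3 defO; apply/allP => x xs2 /=.
have inX y : y \in O -> y \in X by move/h3.
have xO : x \in O by rewrite defO !(mem_cat, inE) xs2 !orbT.
have cO : c \in O by rewrite defO !(mem_cat, inE) eqxx !orbT.
apply/eqP; apply: rinj; rewrite ?inX //; apply/eqP.
move: h2; rewrite defO pairwise_cat => /and3P[_ _ /= /andP[hc]].
rewrite pairwise_cat => /and3P[hx _ _].
rewrite eqn_leq (allP hc x) ?mem_cat ?xs2 // andbT.
by move/allrelP: hx; apply=> //; rewrite mem_head.
Qed.

(* The words that, up to repetitions, can lie on the stack. *)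
Definition clustered X :=
  all (fun c => all (fun d => (c == d) || ~~ subseq [:: c; d; c] X) X) X.

Lemma clusteredP X :
  reflect (forall c d, c <> d -> ~~ subseq [:: c; d; c] X) (clustered X).
Proof.
apply: (iffP idP) => [h c d cd|h].
  apply/negP => sub; have m y : y \in [:: c; d; c] -> y \in X by apply: mem_subseq.
  have /allP/(_ d) := allP h c (m _ (mem_head _ _)).
  by rewrite m ?inE ?eqxx ?orbT // => /(_ isT)/orP[/eqP//|/negP].
apply/allP => c _; apply/allP => d _; case: (altP eqP) => //= /eqP; exact: h.
Qed.

Lemma clusteredPn X : ~~ clustered X ->
  exists c d, c <> d /\ subseq [:: c; d; c] X.
Proof.
move=> /allPn[c _ /allPn[d _]]; rewrite negb_or negbK => /andP[/eqP cd h].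
by exists c, d.
Qed.

Lemma clustered_subseq X Y : subseq X Y -> clustered Y -> clustered X.
Proof.
move=> sXY /clusteredP h; apply/clusteredP => c d cd.
by apply: contra (h c d cd) => /subseq_trans; apply.
Qed.

(* The colors in [D] are popped as soon as they are pushed, then all the socks
   of color [z] are output. *)
Lemma sortable_act S U (V : seq T) z (D : pred T) :
    z \notin V -> ~~ D z ->
    (forall v, z <> v -> ~~ subseq [:: z; v] S) ->
    (forall w, D w -> [/\ w \notin S, w \notin V &
       forall d, w <> d -> ~~ subseq [:: w; d; w] (S ++ U)]) ->
    (forall v w, D w -> ~~ D v -> z <> v -> ~~ subseq [:: z; v; w] (S ++ U)) ->
    sortable [seq x <- S ++ U | (x != z) && ~~ D x] V ->
  sortable S (U ++ z :: V).
Proof.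
move=> zV Dz topz HD zvw [r' [rinj rdec r231]].
set X := S ++ U ++ z :: V; set F := filter _ _ in rinj rdec r231.
pose N := size X.
(* Colors in [D] come out first, by the position of their first sock, then [z], then the rest as
   [r'] says; [N] and [N.+1] keep the three groups apart. *)
pose r x := if D x then index x X else if x == z then N else N.+1 + r' x.
have iN x : x \in X -> index x X < N by rewrite /N index_mem.
have XE x : x \in X -> ~~ D x -> x != z -> x \in F ++ V.
  rewrite /X !mem_cat inE mem_filter mem_cat => + nD xz.
  by rewrite nD xz (negPf xz) /= orbA.
have big k : N < N.+1 + k by rewrite addSn ltnS leq_addr.
have DltnD x y : x \in X -> D x -> ~~ D y -> r x < r y.
  move=> xX Dx nDy; rewrite /r Dx (negPf nDy); case: eqP => _; first exact: iN.
  exact: ltn_trans (iN x xX) (big _).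
have rinj2 : {in X &, injective r}.
  move=> x y xX yX; have [Dx|nDx] := boolP (D x); have [Dy|nDy] := boolP (D y).
  - by rewrite /r Dx Dy => e; rewrite -(nth_index x xX) e nth_index.
  - by move=> e; have := DltnD x y xX Dx nDy; rewrite e ltnn.
  - by move=> e; have := DltnD y x yX Dy nDx; rewrite e ltnn.
  rewrite /r (negPf nDx) (negPf nDy); case: eqP => [->|/eqP xz]; case: eqP => [->|/eqP yz] //.
  - by move=> e; have := big (r' y); rewrite -e ltnn.
  - by move=> e; have := big (r' x); rewrite e ltnn.
  by move/addnI; apply: rinj; exact: XE.
have nz x y : ~~ D x -> ~~ D y -> r x < r y -> y <> z.
  move=> nDx nDy; rewrite /r (negPf nDx) (negPf nDy) => + yz; rewrite yz eqxx.
  by case: eqP => _; rewrite ?ltnn // ltnNge ltnW.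
have memX s x : subseq s X -> x \in s -> x \in X by move/mem_subseq; apply.
have before x s : subseq (rcons s x) X -> x \notin V -> x != z ->
    subseq (rcons s x) (S ++ U).
  rewrite /X catA => /subseq_catP[k ks /andP[h1 h2]] xV xz.
  case: (ltngtP k (size s).+1) => [lk|lk|ek].
  - have : x \in drop k (rcons s x).
      by rewrite -cats1 drop_cat; case: ltnP => h;
        rewrite ?mem_cat ?inE ?eqxx ?orbT // (eqP (_ : k - size s == 0)) ?inE //
        subn_eq0 -ltnS.
    by move/(mem_subseq h2); rewrite inE (negPf xz) (negPf xV).
  - by move: ks; rewrite size_rcons leqNgt lk.
  - by move: h1; rewrite take_oversize // size_rcons ek.
exists r; split=> //.
- move=> u v uv uneq.
  have uS : u \in S by apply: (mem_subseq uv); rewrite mem_head.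
  have vS : v \in S by apply: (mem_subseq uv); rewrite !inE eqxx orbT.
  have nDu : ~~ D u by apply/negP => /HD[]; rewrite uS.
  have nDv : ~~ D v by apply/negP => /HD[]; rewrite vS.
  have uz : u != z.
    apply/eqP => uz; move: uv uneq; rewrite uz => zv zneq.
    by move: (topz v zneq); rewrite zv.
  rewrite /r (negPf nDu) (negPf nDv) (negPf uz).
  case: eqP => [_|/eqP vz]; first by rewrite addSn ltnS leq_addr.
  rewrite ltn_add2l; apply: rdec => //; rewrite subseq_filter /= nDu nDv uz vz /=.
  by apply: subseq_trans uv (prefix_subseq _ _).
move=> u v w sub wu uv.
have uX : u \in X by apply: (memX _ _ sub); rewrite mem_head.
have vX : v \in X by apply: (memX _ _ sub); rewrite !inE eqxx orbT.
have wX : w \in X by apply: (memX _ _ sub); rewrite !inE eqxx !orbT.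
have une : u <> v by move=> e; move: uv; rewrite e ltnn.
have wne : w <> u by move=> e; move: wu; rewrite e ltnn.
have wne2 : w <> v by move=> e; move: (ltn_trans wu uv); rewrite e ltnn.
have [Dw|nDw] := boolP (D w).
  have [wS wV wcl] := HD w Dw.
  have wz : w != z by apply: contra Dz => /eqP <-.
  have sub' : subseq [:: u; v; w] (S ++ U) by apply: (before w [:: u; v]).
  (* Inside [D] ranks are first positions, so [w] also occurs before [u], and [w u w] contradicts
     the adjacency of the socks of [w]. *)
  have [Du|nDu] := boolP (D u).
    move: wu; rewrite /r Dw Du => wu.
    have : subseq [:: w; u; w] (S ++ U).
      have : subseq [:: u; w] (S ++ U).
        by apply: subseq_trans sub'; rewrite /= eqxx; case: eqP => _; rewrite ?eqxx.
      have wSU : w \in S ++ U.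
        by apply: (mem_subseq sub'); rewrite !inE eqxx !orbT.
      move: wu; rewrite /X catA (index_cat w (S ++ U)) (index_cat u (S ++ U)) wSU.
      have -> : u \in S ++ U by apply: (mem_subseq sub'); rewrite mem_head.
      by move=> h hs; apply: (index_ltn_subseq _ h hs) => /esym.
    by apply/negP/wcl.
  have [Dv|nDv] := boolP (D v).
    by have := ltn_trans uv (DltnD v u vX Dv nDu); rewrite ltnn.
  have vz : v <> z by exact: nz uv.
  have [uz|/eqP uz] := eqVneq u z.
    move: sub' une; rewrite uz => sub' une.
    by move: (zvw v w Dw nDv une); rewrite sub'.
  have : r v < r u; last by move=> /(ltn_trans uv); rewrite ltnn.
  rewrite /r (negPf nDu) (negPf nDv); rewrite (introF eqP uz) (introF eqP vz).
  rewrite ltn_add2l; apply: rdec => //.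
  rewrite subseq_filter /= nDu nDv; rewrite (introF eqP uz) (introF eqP vz).
  by apply: subseq_trans sub'; rewrite -[[:: u; v; w]]/([:: u; v] ++ [:: w]) prefix_subseq.
have nDu : ~~ D u.
  by apply/negP => Du; have := ltn_trans wu (DltnD u w uX Du nDw); rewrite ltnn.
have nDv : ~~ D v.
  by apply/negP => Dv; have := ltn_trans uv (DltnD v u vX Dv nDu); rewrite ltnn.
have uz : u <> z by exact: nz wu.
have vz : v <> z by exact: nz uv.
move: wu uv; rewrite /r (negPf nDu) (negPf nDv) (negPf nDw).
rewrite (introF eqP uz) (introF eqP vz).
(* As [z] has no sock in [V], both [u] and [v] lie in [S ++ U], hence on the new stack, where [r']
   decreases. *)
have [wz _|wz] := eqVneq w z.
  rewrite ltn_add2l => uv.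
  have : r' v < r' u; last by move=> /(ltn_trans uv); rewrite ltnn.
  apply: rdec => //; rewrite subseq_filter /= nDu nDv; rewrite (introF eqP uz) (introF eqP vz).
  have /subseq_catP[k _ /andP[h1 h2]] : subseq [:: u; v; z] ((S ++ U) ++ z :: V).
    by rewrite -catA -[X in [:: u; v; X]]wz.
  case: k h1 h2 => [|[|k]].
  - rewrite /= (introF eqP uz) => _ /mem_subseq/(_ z).
    by rewrite !inE eqxx !orbT (negPf zV) => /(_ isT).
  - rewrite /= (introF eqP vz) => _ /mem_subseq/(_ z).
    by rewrite !inE eqxx !orbT (negPf zV) => /(_ isT).
  by move=> h _ /=; apply: subseq_trans h; rewrite /= !eqxx sub0seq.
rewrite !ltn_add2l => wu uv; apply: (r231 u v w) => //.
have : subseq [:: u; v; w] [seq x <- X | (x != z) && ~~ D x].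
  rewrite subseq_filter /= nDu nDv nDw wz sub.
  by rewrite (introF eqP uz) (introF eqP vz).
move=> /subseq_trans; apply; rewrite /X catA filter_cat /= eqxx /=.
by rewrite cat_subseq // filter_subseq.
Qed.

End Rank.

(* [chain a t_0 [:: t_1; ...; t_n]] is the word I(t_0, ..., t_n) a t_n. *)
Fixpoint chain (T : Type) (a t : T) (ts : seq T) : seq T :=
  if ts is u :: ts' then u :: t :: chain a u ts' else [:: a; t].

(** * Obstructions of words and of states *)

Section Obstructions.
Variable T : eqType.
Implicit Types (S R X : seq T).

Definition has_Gamma X := exists2 Z, subseq Z X & Gamma Z.

(* Up to words that are not foot-sortable themselves, the minimal unsortable
   states are those of [chain_obs] and [short_obs]. *)
Definition chain_obs S R := exists a b t ts,
  [/\ uniq [:: a; b; t], subseq [:: a; b; t] S, b \notin ts &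
      subseq (chain a t ts) R].

Definition short_obs S R := exists a b c,
  [/\ uniq [:: a; b; c], subseq [:: a; b] S &
      [\/ subseq [:: a; c; a; b] R, subseq [:: c; a; b; c] R,
          subseq [:: c; a; c; b] R |
          exists2 d, d \notin [:: a; b; c] & subseq [:: a; c; d; c; b] R]].

Definition obs S R := [\/ has_Gamma (S ++ R), chain_obs S R | short_obs S R].

Lemma has_Gamma_subseq X Y : subseq X Y -> has_Gamma X -> has_Gamma Y.
Proof. by move=> sXY [Z sZ GZ]; exists Z => //; apply: subseq_trans sXY. Qed.

Lemma obs_subseq S R S' R' :
  subseq S' S -> subseq R' R -> obs S' R' -> obs S R.
Proof.
move=> sS sR [h|[a [b [t [ts [h1 h2 h3 h4]]]]]|[a [b [c [h1 h2 h3]]]]].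
- by apply: Or31; apply: has_Gamma_subseq h; rewrite cat_subseq.
- apply: Or32; exists a, b, t, ts; split=> //.
    exact: subseq_trans sS.
  exact: subseq_trans sR.
apply: Or33; exists a, b, c; split=> //; first exact: subseq_trans sS.
case: h3 => [h|h|h|[d hd h]]; [apply: Or41|apply: Or42|apply: Or43|apply: Or44];
  try exact: subseq_trans sR.
by exists d => //; exact: subseq_trans sR.
Qed.

Lemma obs_nil R : obs [::] R -> has_Gamma R.
Proof. by case=> // [[a [b [t [ts [_]]]]]|[a [b [c [_]]]]]. Qed.

End Obstructions.

(** * Checking finite configurations by computation *)

(** [undup] keeps the last copy of each letter, so the two reversals list the letters by first
    occurrence. In a [normal] pattern a new letter is thus the number of letters met so far, which
    is how [embed] recognizes it. *)
Definition letters (g : seq nat) := rev (undup (rev g)).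
Definition normal (g : seq nat) := map (index^~ (letters g)) g.

(** Only chains with at most one link enter the computation, here and in [committed_table]; longer
    ones are treated by induction on the links. The shift [addn 4] keeps the chain colors apart from
    0 to 3. *)
Definition Gamma_sample : seq (seq nat) :=
  map word (Gamma_i ++ Gamma_ii ++ Gamma_iii) ++
  Gamma_iv 0 1 2 3 (addn 4) 0 ++ Gamma_iv 0 1 2 3 (addn 4) 1.

Definition Gamma_table : seq (nat * seq nat) :=
  Eval vm_compute in [seq (size (letters g), normal g) | g <- Gamma_sample].

(* Number of colors, socks on the stack and remaining input of an obstruction. *)
Definition committed_table : seq (nat * seq nat * seq nat) :=
  [:: (3, [:: 0; 1], [:: 0; 2; 0; 1]); (3, [:: 0; 1], [:: 2; 0; 1; 2]);
      (3, [:: 0; 1], [:: 2; 0; 2; 1]); (4, [:: 0; 1], [:: 0; 2; 3; 2; 1]);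
      (3, [:: 0; 1; 2], [:: 0; 2]); (4, [:: 0; 1; 2], [:: 3; 2; 0; 3])].

(* Searches [w] for a copy of the normalized pattern [g]; [L] lists the colors
   already assigned to letters, and at most [k] more socks of [w] may be skipped. *)
Fixpoint embed (w g : seq nat) (L : seq nat) (k : nat) : option (seq nat) :=
  match g with
  | [::] => Some L
  | d :: g' => if w is c :: w' then
      let r := if d < size L then
                 if c == nth 0 L d then embed w' g' L k else None
               else if c \in L then None else embed w' g' (rcons L c) k in
      if r is Some _ then r else if k is k'.+1 then embed w' g L k' else None
    else None
  end.

(** Stack and input must share one assignment of colors, so they are searched as a single word with
    a separator, a number that no configuration uses as a letter. In the pattern the separator is
    the first letter after those of [gS], and the new letters of [gR] move up by one. The answer of
    [embed] is only a hint: distinctness and both subsequences are tested again, and soundness rests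
    on these tests alone. *)
Definition matches (ws wr : seq nat) (k : nat) (gS gR : seq nat) : bool :=
  let sep := 1000 in
  if embed (ws ++ sep :: wr)
       (gS ++ (foldr maxn 0 gS).+1 :: map (fun i => i + (foldr maxn 0 gS < i)) gR)
       [::] (size ws + size wr - size gS - size gR) is Some L0 then
    let L := filter (predC1 sep) L0 in
    [&& size L == k, uniq L, all (mem (ws ++ wr)) L,
        subseq (map (nth 0 L) gS) ws & subseq (map (nth 0 L) gR) wr]
  else false.

Definition found (w : seq nat) (k : nat) (g : seq nat) : bool :=
  if embed w g [::] (size w - size g) is Some L then
    [&& size L == k, uniq L, all (mem w) L & subseq (map (nth 0 L) g) w]
  else false.

Definition bad_pair (ws wr : seq nat) : bool :=
  has (fun g => found (ws ++ wr) g.1 g.2) Gamma_table ||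
  has (fun g => matches ws wr g.1.1 g.1.2 g.2) committed_table.

(** Common superwords of two words. If both begin with the same letter, only its joint use is
    listed: in a word containing both, the first sock of that color serves both. *)
Fixpoint merges (p : seq nat) : seq nat -> seq (seq nat) :=
  fix merges_p (q : seq nat) : seq (seq nat) :=
  match p, q with
  | [::], _ => [:: q]
  | _, [::] => [:: p]
  | c :: p', d :: q' =>
      if c == d then map (cons c) (merges p' q')
      else map (cons c) (merges p' q) ++ map (cons d) (merges_p q')
  end.

Lemma merges_subseq (T : eqType) (f : nat -> T) (p q : seq nat) (X : seq T) :
    {in p ++ q &, injective f} ->
    subseq (map f p) X -> subseq (map f q) X ->
  exists2 w, w \in merges p q & subseq (map f w) X /\ {subset w <= p ++ q}.
Proof.
elim: X p q => [|x X IH] p q finj.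
  rewrite !subseq0 => /eqP/(congr1 size) + /eqP/(congr1 size).
  rewrite !size_map => /size0nil-> /size0nil->.
  by exists [::]; [rewrite /= inE | split].
have nil_l : forall q, merges [::] q = [:: q] by case.
have nil_r : forall p, merges p [::] = [:: p] by case.
case: p finj => [|c p] finj sp sq.
  by exists q; [rewrite nil_l inE | split].
case: q finj sq => [|d q] finj sq.
  by exists (c :: p); [rewrite nil_r inE | rewrite cats0; split].
have cin : c \in (c :: p) ++ d :: q by rewrite mem_head.
have din : d \in (c :: p) ++ d :: q by rewrite mem_cat mem_head orbT.
have sub1 : {subset p ++ d :: q <= (c :: p) ++ d :: q}.
  by move=> i; rewrite [in X in _ -> X]inE => ->; rewrite orbT.
have sub2 : {subset (c :: p) ++ q <= (c :: p) ++ d :: q}.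
  by move=> i; rewrite !mem_cat [i \in d :: q]inE => /orP[->|->]; rewrite ?orbT.
have sub3 : {subset p ++ q <= (c :: p) ++ d :: q}.
  by move=> i h; apply: sub2; rewrite /= inE h orbT.
have cut (s : seq nat) : {subset s <= (c :: p) ++ d :: q} ->
    {in s &, injective f}.
  by move=> sP i j hi hj; apply: finj; apply: sP.
move: sp sq => /=; case: (eqVneq (f c) x) => [fc|fc] sp;
  case: (eqVneq (f d) x) => [fd|fd] sq.
- have cd : c = d by apply: finj; rewrite // fc.
  have [w w1 [w2 w3]] := IH p q (cut _ sub3) sp sq.
  have -> : (c == d) = true by rewrite cd eqxx.
  exists (c :: w); first by rewrite map_f.
  split; first by rewrite /= fc eqxx.
  by move=> i; rewrite inE => /orP[/eqP->|/w3/sub3].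
- have [w w1 [w2 w3]] := IH p (d :: q) (cut _ sub1) sp sq.
  have cd : c != d by apply: contra fd => /eqP <-; rewrite fc.
  rewrite (negPf cd); exists (c :: w); first by rewrite mem_cat map_f.
  split; first by rewrite /= fc eqxx.
  by move=> i; rewrite inE => /orP[/eqP->|/w3/sub1].
- have [w w1 [w2 w3]] := IH (c :: p) q (cut _ sub2) sp sq.
  have cd : c != d by apply: contra fc => /eqP ->; rewrite fd.
  rewrite (negPf cd); exists (d :: w); first by rewrite mem_cat; apply/orP; right; rewrite map_f.
  split; first by rewrite /= fd eqxx.
  by move=> i; rewrite inE => /orP[/eqP->|/w3/sub2].
have [w w1 [w2 w3]] := IH (c :: p) (d :: q) finj sp sq.
exists w => //; split=> //.
exact: subseq_trans w2 (subseq_cons _ _).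
Qed.

Definition segment_words (ps : seq (seq nat)) : seq (seq nat) :=
  foldr (fun p ws => flatten [seq merges p w | w <- ws]) [:: [::]] ps.

Definition words_of (rs : seq (seq (seq nat))) : seq (seq nat) :=
  foldr (fun ps ws => [seq v ++ w | v <- segment_words ps, w <- ws]) [:: [::]] rs.

(** Each letter goes to a letter not larger than itself. The idempotent assignments, selected by
    [admissible], are the partitions of the letters, each letter going to the least one of its
    class; they enumerate all coincidences of colors. *)
Fixpoint assignments (n : nat) : seq (seq nat) :=
  if n is k.+1 then [seq rcons m j | m <- assignments k, j <- iota 0 n]
  else [:: [::]].

Definition admissible (neq eqs : seq (nat * nat)) (m : seq nat) : bool :=
  [&& all (fun i => nth 0 m (nth 0 m i) == nth 0 m i) (iota 0 (size m)),
      all (fun ij => nth 0 m ij.1 != nth 0 m ij.2) neq &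
      all (fun ij => nth 0 m ij.1 == nth 0 m ij.2) eqs].

(** [ps] lists words known to lie in the stack, and each member of [rs] lists words known to lie in
    one segment of the input. Obstructions pass to superwords, so it suffices to find one in every
    merged word. *)
Definition check (n : nat) (neq eqs : seq (nat * nat)) (ps : seq (seq nat))
    (rs : seq (seq (seq nat))) : bool :=
  all (fun m => let sub := map (map (nth 0 m)) in
    let wrs := words_of (map sub rs) in
    all (fun ws => clustered ws ==> all (bad_pair ws) wrs)
      (segment_words (sub ps)))
    (filter (admissible neq eqs) (assignments n)).

Lemma segment_words_subseq (T : eqType) (f : nat -> T) (ps : seq (seq nat))
    (X : seq T) (A : seq nat) :
    {in A &, injective f} -> {in ps, forall p, {subset p <= A}} ->
    {in ps, forall p, subseq (map f p) X} ->
  exists2 w, w \in segment_words ps & subseq (map f w) X /\ {subset w <= A}.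
Proof.
move=> finj; elim: ps => [|p ps IH] pA pX.
  by exists [::]; rewrite ?inE //; split; rewrite ?sub0seq.
have [||w w1 [w2 w3]] := IH.
- by move=> q qps; apply: pA; rewrite inE qps orbT.
- by move=> q qps; apply: pX; rewrite inE qps orbT.
have [|||v v1 [v2 v3]] := @merges_subseq _ f p w X.
- move=> i j hi hj; apply: finj; [move: hi|move: hj];
    by rewrite mem_cat => /orP[|/w3] //; apply: pA; rewrite mem_head.
- by apply: pX; rewrite mem_head.
- by [].
exists v; last split=> //.
  by apply/flattenP; exists (merges p w) => //; apply: map_f.
move=> i /v3; rewrite mem_cat => /orP[|/w3] //; apply: pA; exact: mem_head.
Qed.

Fixpoint all2P (A B : Type) (P : A -> B -> Prop) s t : Prop :=
  match s, t with
  | a :: s', b :: t' => P a b /\ all2P P s' t'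
  | [::], [::] => True
  | _, _ => False
  end.

Lemma words_of_subseq (T : eqType) (f : nat -> T) (rs : seq (seq (seq nat)))
    (Rs : seq (seq T)) (A : seq nat) :
    {in A &, injective f} ->
    (forall ps p, ps \in rs -> p \in ps -> {subset p <= A}) ->
    all2P (fun ps X => {in ps, forall p, subseq (map f p) X}) rs Rs ->
  exists2 w, w \in words_of rs &
    subseq (map f w) (flatten Rs) /\ {subset w <= A}.
Proof.
move=> finj; elim: rs Rs => [|ps rs IH] [|X Rs] //= psA.
  by exists [::]; rewrite ?inE.
case=> hX /IH[|w w1 [w2 w3]].
  by move=> q p qrs; apply: psA; rewrite inE qrs orbT.
have [|v v1 [v2 v3]] := @segment_words_subseq _ f ps X A finj _ hX.
  by move=> p; apply: psA; rewrite mem_head.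
exists (v ++ w); first exact: allpairs_f.
split; first by rewrite map_cat cat_subseq.
by move=> i; rewrite mem_cat => /orP[/v3|/w3].
Qed.

Lemma Gamma_table_sound (T : eqType) (x0 : T) L k g :
    (k, g) \in Gamma_table -> size L = k -> uniq L ->
  Gamma (map (nth x0 L) g).
Proof.
move=> gin szL uL.
have [s s1 [ek ->]] : exists2 s, s \in Gamma_sample &
    k = size (letters s) /\ g = normal s.
  move: gin.
  (* This identifies the table, stored in evaluated form, with its defining expression. *)
  have -> : Gamma_table = [seq (size (letters g), normal g) | g <- Gamma_sample].
    by vm_cast_no_check (erefl Gamma_table).
  by case/mapP => s s1 [-> ->]; exists s.
have eqv : equivalent (map (nth x0 L) (normal s)) s.
  rewrite ek in szL; set u := letters s in szL *.
  have uu : uniq u by rewrite rev_uniq undup_uniq.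
  have memu : u =i s by move=> i; rewrite mem_rev mem_undup mem_rev.
  have idx k' : k' < size u -> index (nth x0 L k') L = k'.
    by move=> lk; rewrite index_uniq // szL.
  have inZ c : c \in map (nth x0 L) (normal s) -> exists2 k', k' < size u & c = nth x0 L k'.
    case/mapP => j /mapP[i iss ->] ->.
    by exists (index i u) => //; rewrite index_mem memu.
  exists (fun c => nth 0 u (index c L)); split.
    move=> c d /inZ[i hi ->] /inZ[j hj ->]; rewrite !idx // => /eqP.
    by rewrite nth_uniq // => /eqP ->.
  rewrite -map_comp -map_comp -[RHS]map_id; apply/eq_in_map => i iss /=.
  by rewrite idx ?nth_index ?memu // index_mem memu.
move: s1; rewrite /Gamma_sample mem_cat => /orP[s1|]; first by left; exists s.
by rewrite mem_cat => /orP[] s1; right;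
  [exists 0|exists 1]; exists 0, 1, 2, 3, (addn 4); split=> //; exists s.
Qed.

Lemma bad_pair_sound (T : eqType) (f : nat -> T) (ws wr A : seq nat)
    (S R : seq T) :
    {in A &, injective f} -> {subset ws <= A} -> {subset wr <= A} ->
    subseq (map f ws) S -> subseq (map f wr) R -> bad_pair ws wr ->
  obs S R.
Proof.
move=> finj wsA wrA hS hR.
have wA : {subset ws ++ wr <= A} by move=> i; rewrite mem_cat => /orP[/wsA|/wrA].
have uf L : uniq L -> all (mem (ws ++ wr)) L -> uniq (map f L).
  move=> uL /allP mL; rewrite map_inj_in_uniq // => i j /mL/wA hi /mL/wA hj.
  exact: finj.
have mf L g : map f (map (nth 0 L) g) = map (nth (f 0) (map f L)) g.
  rewrite -map_comp; apply: eq_map => i /=.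
  have [iL|Li] := ltnP i (size L); first by rewrite (nth_map 0).
  by rewrite !nth_default ?size_map.
case/orP => /hasP[].
  move=> [k g] gin; rewrite /found /=; case: embed => // L.
  case/and4P => /eqP szL uL mL sub; apply: Or31.
  exists (map (nth (f 0) (map f L)) g); last first.
    by apply: (Gamma_table_sound _ gin); rewrite ?size_map // uf.
  rewrite -mf; apply: subseq_trans (map_subseq f sub) _.
  by rewrite map_cat cat_subseq.
move=> [[k gS] gR] gin; rewrite /matches; case: embed => // L0.
move: (filter _ _) => L /and5P[/eqP szL uL mL subS subR].
have {subS} := subseq_trans (map_subseq f subS) hS.
have {subR} := subseq_trans (map_subseq f subR) hR.
rewrite !mf; have := uf L uL mL.
have : size (map f L) = k by rewrite size_map.
move: (map f L) (f 0) => {szL uL mL L0 mf uf hS hR}{}L x0.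
move: gin; rewrite /committed_table !inE.
case/or3P=> [||/or4P[]] /eqP[-> -> ->]; case: L => [|a [|b [|c [|d [|? ?]]]]] // _ /=;
  rewrite ?andbT => u sR sS.
- by apply: Or33; exists a, b, c; split=> //; [rewrite /= andbT|apply: Or41].
- by apply: Or33; exists a, b, c; split=> //; [rewrite /= andbT|apply: Or42].
- by apply: Or33; exists a, b, c; split=> //; [rewrite /= andbT|apply: Or43].
- apply: Or33; exists a, b, c; move: u; rewrite !inE !negb_or -!andbA.
  case/and5P => ab ac ad bc /andP[bd cd]; split=> //.
    by rewrite /= !inE !negb_or ab ac bc.
  apply: Or44; exists d => //.
  by rewrite !inE !negb_or ![d == _]eq_sym ad bd cd.
- by apply: Or32; exists a, b, c, [::]; split=> //=; rewrite andbT.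
apply: Or32; exists a, b, c, [:: d]; move: u; rewrite !inE !negb_or -!andbA.
case/and5P => ab ac ad bc /andP[bd cd]; split=> //=.
by rewrite /= !inE !negb_or ab ac bc.
Qed.

Lemma assignments_mem l : (forall i, i < size l -> nth 0 l i <= i) ->
  l \in assignments (size l).
Proof.
elim/last_ind: l => // l j IH h; rewrite size_rcons /=.
apply/flatten_mapP; exists l.
  apply: IH => i il; have := h i; rewrite size_rcons nth_rcons il.
  by apply; rewrite ltnS ltnW.
apply: (@map_f _ _ (rcons l) (iota 0 (size l).+1)).
rewrite mem_iota /= add0n ltnS.
by have := h (size l); rewrite size_rcons nth_rcons ltnn eqxx; apply.
Qed.

Definition facts (T : eqType) (f : nat -> T) (ps : seq (seq nat)) (X : seq T) :=
  foldr (fun p P => subseq (map f p) X /\ P) True ps.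

Lemma factsP (T : eqType) (f : nat -> T) ps (X : seq T) :
  facts f ps X -> {in ps, forall p, subseq (map f p) X}.
Proof.
elim: ps => //= p ps IH [h /IH hs] q; rewrite inE => /orP[/eqP->//|]; exact: hs.
Qed.

(* Letter [i] stands for the color [nth c0 cs i]; distinct letters may stand for
   the same color unless [neq] forbids it. *)
Theorem check_sound (T : eqType) (c0 : T) (cs : seq T)
    (neq eqs : seq (nat * nat)) (ps : seq (seq nat)) (rs : seq (seq (seq nat)))
    (S : seq T) (Rs : seq (seq T)) :
    let f := nth c0 cs in
    check (size cs) neq eqs ps rs -> clustered S ->
    all (all (gtn (size cs))) ps && all (all (all (gtn (size cs)))) rs ->
    foldr (fun ij P => f ij.1 <> f ij.2 /\ P) True neq ->
    foldr (fun ij P => f ij.1 = f ij.2 /\ P) True eqs ->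
    all (fun ij => (ij.1 < size cs) && (ij.2 < size cs)) (neq ++ eqs) ->
    facts f ps S -> all2P (facts f) rs Rs ->
  obs S (flatten Rs).
Proof.
move=> f chk clS /andP[rgp rgr] hneq heq rg hS hR.
(* The coincidences that really occur: each letter goes to the first letter of the same color, which
   makes [f] injective on the set [A] of representatives. *)
pose m := map (index^~ cs) cs.
have szm : size m = size cs by rewrite size_map.
have mE i : i < size cs -> nth 0 m i = index (f i) cs.
  by move=> ic; rewrite (nth_map c0).
have mlt i : i < size cs -> nth 0 m i < size cs.
  by move=> ic; rewrite mE // index_mem mem_nth.
have fm i : i < size cs -> f (nth 0 m i) = f i.
  by move=> ic; rewrite mE // /f nth_index // mem_nth.
have min : m \in filter (admissible neq eqs) (assignments (size cs)).
  rewrite mem_filter -szm assignments_mem ?andbT; last first.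
    rewrite szm => i ic; rewrite mE // leqNgt; apply/negP => h.
    by have := before_find c0 h; rewrite /= eqxx.
  apply/and3P; split.
  - apply/allP => i; rewrite mem_iota add0n szm => /andP[_ ic].
    by rewrite (mE (nth 0 m i)) ?mlt // fm // -mE.
  - move: hneq rg; rewrite all_cat => + /andP[+ _].
    elim: neq {chk} => //= [[i j] neq IH] /= [h1 h2] /andP[/andP[h3 h4] h5].
    rewrite IH // andbT; apply/negP => /eqP e.
    by apply: h1; rewrite -fm // e fm.
  move: heq rg; rewrite all_cat => + /andP[_ +].
  elim: eqs {chk} => //= [[i j] eqs IH] /= [h1 h2] /andP[/andP[h3 h4] h5].
  by rewrite IH // andbT !mE // h1.
move/allP: chk => /(_ _ min) /allP chk.
pose A := [seq i <- iota 0 (size cs) | nth 0 m i == i].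
have inA i : i < size cs -> nth 0 m i \in A.
  move=> ic; rewrite mem_filter mem_iota /= add0n mlt // andbT.
  by rewrite mE ?mlt // fm // -mE.
have finj : {in A &, injective f}.
  move=> i j; rewrite !mem_filter !mem_iota /= !add0n.
  move=> /andP[/eqP hi li] /andP[/eqP hj lj] e.
  by rewrite -hi -hj !mE // e.
pose mm := map (map (nth 0 m)).
have mmA ps' : all (all (gtn (size cs))) ps' ->
    {in mm ps', forall p, {subset p <= A}}.
  move=> rg' p /mapP[q /(allP rg')/allP hq ->] i /mapP[j /hq jc ->]; exact: inA.
have mmf ps' X : all (all (gtn (size cs))) ps' -> facts f ps' X ->
    {in mm ps', forall p, subseq (map f p) X}.
  move=> rg' /factsP h p /mapP[q qps ->]; have := h q qps.
  rewrite -map_comp; congr (subseq _ _); apply/eq_in_map => i iq /=.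
  by rewrite fm //; exact: (allP (allP rg' q qps)).
have [ws w1 [w2 w3]] := segment_words_subseq finj (mmA _ rgp) (mmf _ _ rgp hS).
have [||wr v1 [v2 v3]] := @words_of_subseq _ f (map mm rs) Rs A finj.
- move=> ps' p /mapP[qs qrs ->]; apply: mmA; exact: (allP rgr).
- elim: (rs) (Rs) rgr hR => [|qs rs' IH] [|X Rs'] //= /andP[h1 h2] [h3 h4].
  by split; [apply: mmf | apply: IH].
apply: (bad_pair_sound finj w3 v3 w2 v2).
have /implyP/(_ _)/allP := chk _ w1; apply=> //.
apply/clusteredP => c d cd; apply/negP => sub.
have mws x : x \in [:: c; d; c] -> x \in A by move/(mem_subseq sub)/w3.
have cA : c \in A by apply: mws; rewrite mem_head.
have dA : d \in A by apply: mws; rewrite !inE eqxx orbT.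
have fcd : f c <> f d by move=> e; apply: cd; apply: finj.
move/clusteredP: clS => /(_ _ _ fcd)/negP; apply.
exact: subseq_trans (map_subseq f sub) w2.
Qed.

Lemma obs_check (T : eqType) (c0 : T) (cs : seq T)
    (neq eqs : seq (nat * nat)) (ps : seq (seq nat)) (rs : seq (seq (seq nat)))
    (Rs : seq (seq T)) (S R : seq T) :
    let f := nth c0 cs in
    check (size cs) neq eqs ps rs ->
    all (all (gtn (size cs))) ps && all (all (all (gtn (size cs)))) rs &&
      all (fun ij => (ij.1 < size cs) && (ij.2 < size cs)) (neq ++ eqs) ->
    clustered S -> R = flatten Rs ->
    foldr (fun ij P => f ij.1 <> f ij.2 /\ P) True neq ->
    foldr (fun ij P => f ij.1 = f ij.2 /\ P) True eqs ->
    facts f ps S -> all2P (facts f) rs Rs ->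
  obs S R.
Proof.
move=> f h1 /andP[h2 h3] h4 -> h5 h6 h7 h8.
exact: check_sound h1 h4 h2 h5 h6 h3 h7 h8.
Qed.

Ltac solve_fact :=
  solve [ assumption | exact: sub0seq | apply/nesym; assumption | apply/eqP; assumption
        | apply/eqP; rewrite eq_sym; assumption | reflexivity | symmetry; assumption
        | rewrite [map _ _]/= sub1seq; assumption
        | by rewrite [map _ _]/= sub1seq !(mem_cat, inE) eqxx ?orbT ].

(** Letters number the colors [cs]; pairs of letters listed neither in [neq] nor in [eqs] may
    coincide or not, and all possibilities are tried. After [obs_nil] the stack is empty, and the
    result is a word of Gamma. *)
Ltac check_obs c0 cs neq eqs ps rs Rs :=
  refine (@obs_check _ c0 cs neq eqs ps rs Rs _ _ _ _ _ _ _ _ _ _);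
  [ vm_compute; reflexivity | vm_compute; reflexivity | first [assumption | by []]
  | rewrite /= ?cats0 -?catA //= -?catA //
  | repeat split; try solve_fact | repeat split; try solve_fact
  | repeat split; try solve_fact | repeat split; try solve_fact ].

(** * Chains and the infinite family *)

Lemma map_chain (T U : Type) (f : T -> U) a t ts :
  map f (chain a t ts) = chain (f a) (f t) (map f ts).
Proof. by elim: ts t => //= u ts IH t; rewrite IH. Qed.

(** [I_word] grows at its right end and [chain] at its left end; the growth of a chain at the right
    makes them comparable in [E_word_chain]. *)
Lemma chain_rcons (T : Type) (a t u : T) ts : exists2 w,
  chain a t ts = w ++ [:: a; last t ts] &
  chain a t (rcons ts u) = w ++ [:: u; last t ts; a; u].
Proof.
elim: ts t => [|v ts IH] t /=; first by exists [::].
by have [w -> ->] := IH v; exists (v :: t :: w).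
Qed.

Lemma E_word_chain (a : nat) n : E_word a (addn 4) n = chain a 4 (iota 5 n).
Proof.
elim: n => // n IH.
have -> : iota 5 n.+1 = rcons (iota 5 n) (5 + n) by rewrite -cats1 -(iotaD 5 n 1) addn1.
have [w ew ->] := chain_rcons a 4 (5 + n) (iota 5 n).
have lst : last 4 (iota 5 n) = 4 + n.
  by case: (n) => // k; rewrite -nth_last size_iota nth_iota // addSnnS.
have := IH; rewrite ew lst /E_word => /eqP; rewrite eqseq_cat; last first.
  by move: (congr1 size ew); rewrite -IH !size_cat => /addIn.
move=> /andP[/eqP <- _].
by rewrite /= -catA.
Qed.

(* The letters [0 .. 4] of a head stand for [a], [b], [d], [e], [t_0]. *)
Definition heads : seq (seq nat) :=
  [:: [:: 2; 0; 1; 4; 2]; [:: 0; 2; 1; 4; 2; 1]; [:: 0; 1; 2; 4; 2; 1];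
      [:: 0; 1; 4; 2; 4; 1]; [:: 0; 1; 4; 2; 3; 2; 1]].

Section Chains.
Variable T : eqType.
Implicit Types (a b t u : T) (ts S R X : seq T).

Lemma Gamma_head h a b d e t ts : h \in heads ->
    uniq (a :: b :: d :: t :: ts) ->
    (3 \in h -> e \notin a :: b :: d :: t :: ts) ->
  Gamma (map (nth a [:: a; b; d; e; t]) h ++ chain a t ts).
Proof.
move=> hh uL eh; right; exists (size ts), 0, 1, 2, 3, (addn 4); split.
  rewrite cat_uniq mkseq_uniq ?andbT //=; last exact: addnI.
  by apply/hasPn => i /mapP[k _ ->].
exists (map (nth 0 [:: 0; 1; 2; 3; 4]) h ++ E_word 0 (addn 4) (size ts)).
  move: hh; rewrite !inE /Gamma_iv.
  case/or4P => [||| /orP[]] /eqP->; rewrite /= ?eqxx ?orbT //.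
(* All colors other than [a], [b], [d] and the chain colors go to 3; in the word at hand only [e]
   can be of this kind, and only for the fifth head. *)
pose phi x := if x == a then 0 else if x == b then 1 else if x == d then 2 else
  if x \in t :: ts then 4 + index x (t :: ts) else 3.
have := uL; rewrite /= !inE !negb_or => /and5P[/and4P[ab ad at_ ats]
  /and3P[bd bt bts] /andP[dt dts] tts uts].
have pa : phi a = 0 by rewrite /phi eqxx.
have pb : phi b = 1 by rewrite /phi eq_sym (negPf ab) eqxx.
have pd : phi d = 2 by rewrite /phi !(eq_sym d) (negPf ad) (negPf bd) eqxx.
have pt x : x \in t :: ts -> phi x = 4 + index x (t :: ts).
  move=> xt; rewrite /phi xt; case: eqP => [ex|_].
    by move: xt; rewrite ex inE (negPf at_) (negPf ats).
  case: eqP => [ex|_]; first by move: xt; rewrite ex inE (negPf bt) (negPf bts).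
  by case: eqP => // ex; move: xt; rewrite ex inE (negPf dt) (negPf dts).
have pt0 : phi t = 4 by rewrite pt ?mem_head //= eqxx.
have pe : 3 \in h -> phi e = 3.
  move/eh; rewrite inE negb_or => /andP[/negPf ea].
  rewrite inE negb_or => /andP[/negPf eb].
  by rewrite inE negb_or => /andP[/negPf ed /negPf et]; rewrite /phi ea eb ed et.
have pts : map phi ts = iota 5 (size ts).
  apply: (@eq_from_nth _ 0); rewrite ?size_map ?size_iota // => i hi.
  rewrite (nth_map t) // nth_iota // pt ?inE ?mem_nth ?orbT //.
  have /= := @index_uniq _ t i.+1 (t :: ts) hi; rewrite tts uts => -> //.
have hle i : i \in h -> i < 5.
  move: hh; rewrite !inE.
  by case/or4P => [||| /orP[]] /eqP->; rewrite !inE => h';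
    repeat (case/orP: h' => h'); move/eqP: h' => ->.
exists phi; split; last first.
  rewrite map_cat map_chain pa pt0 pts E_word_chain -map_comp; congr (_ ++ _).
  apply/eq_in_map => i ih /=; move: (hle i ih) (ih).
  by case: i {ih} => [|[|[|[|[|]]]]].
pose L := a :: b :: d :: t :: ts.
have inL x : x \in map (nth a [:: a; b; d; e; t]) h ++ chain a t ts ->
    x \in L \/ x = e /\ 3 \in h.
  rewrite mem_cat => /orP[/mapP[i ih ->]|].
    move: (hle i ih) (ih); rewrite /L !inE.
    by case: i {ih} => [|[|[|[|[|]]]]] //= _ ?; rewrite ?eqxx ?orbT; auto.
  have : {subset chain a t ts <= a :: t :: ts}.
    move: (t); elim: (ts) => [|u ts' IH] t' y //=; rewrite !inE.
    case/or3P => [->|->|/IH]; rewrite ?orbT // !inE.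
    by case/or3P => ->; rewrite ?orbT.
  move=> h' /h'; rewrite /L !inE => /or3P[] ->; rewrite ?orbT; auto.
have phiL : {in L &, injective phi}.
  have ptE x : x \in t :: ts -> 3 < phi x by move=> /pt->.
  have ptI x y : x \in t :: ts -> y \in t :: ts -> phi x = phi y -> x = y.
    move=> hx hy; rewrite !pt // => /addnI ei.
    by rewrite -(nth_index t hx) ei nth_index.
  move=> x y; rewrite /L ![_ \in a :: _]inE ![_ \in b :: _]inE ![_ \in d :: _]inE.
  case/or4P => [/eqP->|/eqP->|/eqP->|hx]; case/or4P => [/eqP->|/eqP->|/eqP->|hy];
    rewrite ?pa ?pb ?pd //; try exact: ptI;
    by [move=> ei; have := ptE _ hx; rewrite ei | move=> ei; have := ptE _ hy; rewrite -ei].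
have ne x : x \in L -> phi x <> 3.
  rewrite /L !inE => /or4P[/eqP->|/eqP->|/eqP->|hx]; rewrite ?pa ?pb ?pd // pt //.
move=> x y /inL[hx|[-> h3]] /inL[hy|[-> h3']] //; first exact: phiL.
  by rewrite (pe h3') => /(ne _ hx).
by rewrite (pe h3) => /esym/(ne _ hy).
Qed.

Lemma chain_end_mem a t ts : a \in chain a t ts.
Proof. by elim: ts t => [|u ts IH] t /=; rewrite !inE ?eqxx // IH !orbT. Qed.

Lemma chain_links_mem a t ts : {subset ts <= chain a t ts}.
Proof.
elim: ts t => [|u ts IH] t //= x; rewrite !inE => /orP[->//|/IH ->].
by rewrite !orbT.
Qed.

Lemma chain_suffix a t u p s :
  subseq (chain a u s) (chain a t (p ++ u :: s)).
Proof.
elim: p t => [|v p IH] t /=.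
  exact: subseq_trans (subseq_cons _ _) (subseq_cons _ _).
exact: subseq_trans (IH v) (subseq_trans (subseq_cons _ _) (subseq_cons _ _)).
Qed.

(** Stopped at its link [h], the chain is one whose final color is [h] in place of [a]. *)
Lemma chain_prefix a t h ts : h \in ts ->
  exists2 p, {subset p <= ts} & subseq (chain h t p) (chain a t ts).
Proof.
case/splitPr=> p s; exists p; first by move=> x; rewrite mem_cat => ->.
elim: p t => [|v p IH] t /=; first by rewrite !eqxx sub0seq.
by rewrite !eqxx IH.
Qed.

(** Gamma requires distinct chain colors. A chain that returns to [t] is shortened by skipping the
    loop, and one that has [a] as a link may end there. *)
Lemma chain_uniq a t ts R : a != t -> subseq (chain a t ts) R ->
  exists ts', [/\ uniq (a :: t :: ts'), {subset ts' <= ts} &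
                  subseq (chain a t ts') R].
Proof.
move=> at_ sub.
suff [ts' [h1 h2 h3]] : exists ts', [/\ uniq (a :: t :: ts'), {subset ts' <= ts} &
                  subseq (chain a t ts') (chain a t ts)].
  by exists ts'; split=> //; exact: subseq_trans sub.
elim: ts t at_ {sub} => [|u ts IH] t at_.
  by exists [::]; split=> //; rewrite /= inE at_.
have tl : subseq (chain a u ts) (chain a t (u :: ts)).
  exact: subseq_trans (subseq_cons _ _) (subseq_cons _ _).
have [<-|au] := eqVneq a u.
  exists [::]; split=> //; first by rewrite /= inE at_.
  by rewrite /= !eqxx sub0seq.
have [ts' [h1 h2 h3]] := IH u au.
have [tu|tu] := eqVneq t u.
  exists ts'; rewrite {1 2}tu; split=> //; last exact: subseq_trans h3 tl.
  by move=> x /h2 hx; rewrite inE hx orbT.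
have [tts|tts] := boolP (t \in ts').
  case/splitPr: tts h1 h2 h3 => p s h1 h2 h3; exists s; split.
  - move: h1; apply: subseq_uniq; rewrite -[a :: t :: s]/([:: a] ++ t :: s).
    rewrite -[a :: u :: _]/([:: a] ++ (u :: p) ++ t :: s).
    by rewrite cat_subseq // suffix_subseq.
  - by move=> x xs; rewrite inE h2 ?orbT // mem_cat inE xs !orbT.
  apply: subseq_trans (chain_suffix a u t p s) _.
  exact: subseq_trans h3 tl.
exists (u :: ts'); split.
- move: h1; rewrite /= !inE !negb_or => /and3P[/andP[_ ->] -> ->].
  by rewrite at_ au tu tts.
- by move=> x; rewrite !inE => /orP[->//|/h2->]; rewrite orbT.
by rewrite /= !eqxx h3.
Qed.

Lemma sub_catr V s X : subseq s X -> subseq s (V ++ X).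
Proof. by move=> h; apply: subseq_trans h (suffix_subseq _ _). Qed.

Lemma sub_cons (x : T) s X : subseq s X -> subseq (x :: s) (x :: X).
Proof. by rewrite /= eqxx. Qed.

Lemma sub_head (x : T) s X1 X2 : x \in X1 -> subseq s X2 ->
  subseq (x :: s) (X1 ++ X2).
Proof. by move=> xX h; rewrite -cat1s cat_subseq // sub1seq. Qed.

Lemma has_Gamma_head h a b d e t ts X : h \in heads ->
    uniq [:: a; b; d; t] -> b \notin ts -> d \notin ts ->
    (3 \in h -> e \notin a :: b :: d :: t :: ts) ->
    subseq (map (nth a [:: a; b; d; e; t]) h ++ chain a t ts) X ->
  has_Gamma X.
Proof.
move=> hh u4 bts dts ets sub.
have at_ : a != t by move: u4; rewrite /= !inE !negb_or => /and4P[/and3P[]].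
have [ts' [h1 h2 h3]] := chain_uniq at_ (subseq_refl (chain a t ts)).
exists (map (nth a [:: a; b; d; e; t]) h ++ chain a t ts').
  by apply: subseq_trans sub; rewrite cat_subseq.
apply: Gamma_head => //; last first.
  move=> /ets; apply: contra; rewrite !inE.
  by case/or4P => [->|->|->|/orP[->|/h2 ->]]; rewrite ?orbT.
move: h1 u4; rewrite /= !inE !negb_or !andbT.
case/and3P => /andP[_ ->] -> -> /and3P[/and3P[-> -> ->] /andP[-> ->] ->] /=.
by rewrite andbT; apply/andP; split; [apply: contra bts|apply: contra dts]; exact: h2.
Qed.

Lemma Gamma_I1 a b d t ts X : uniq [:: a; b; d; t] -> b \notin ts -> d \notin ts ->
  subseq ([:: d; a; b; t; d] ++ chain a t ts) X -> has_Gamma X.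
Proof.
move=> h1 h2 h3.
by apply: (has_Gamma_head (h := [:: 2; 0; 1; 4; 2]) (e := a) _ h1 h2 h3).
Qed.

Lemma Gamma_I2 a b d t ts X : uniq [:: a; b; d; t] -> b \notin ts -> d \notin ts ->
  subseq ([:: a; d; b; t; d; b] ++ chain a t ts) X -> has_Gamma X.
Proof.
move=> h1 h2 h3.
by apply: (has_Gamma_head (h := [:: 0; 2; 1; 4; 2; 1]) (e := a) _ h1 h2 h3).
Qed.

Lemma Gamma_I3 a b d t ts X : uniq [:: a; b; d; t] -> b \notin ts -> d \notin ts ->
  subseq ([:: a; b; d; t; d; b] ++ chain a t ts) X -> has_Gamma X.
Proof.
move=> h1 h2 h3.
by apply: (has_Gamma_head (h := [:: 0; 1; 2; 4; 2; 1]) (e := a) _ h1 h2 h3).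
Qed.

Lemma Gamma_I4 a b d t ts X : uniq [:: a; b; d; t] -> b \notin ts -> d \notin ts ->
  subseq ([:: a; b; t; d; t; b] ++ chain a t ts) X -> has_Gamma X.
Proof.
move=> h1 h2 h3.
by apply: (has_Gamma_head (h := [:: 0; 1; 4; 2; 4; 1]) (e := a) _ h1 h2 h3).
Qed.

Lemma Gamma_I5 a b d e t ts X : uniq [:: a; b; d; t] -> b \notin ts -> d \notin ts ->
  e \notin a :: b :: d :: t :: ts ->
  subseq ([:: a; b; t; d; e; d; b] ++ chain a t ts) X -> has_Gamma X.
Proof.
move=> h1 h2 h3 h4.
by apply: (has_Gamma_head (h := [:: 0; 1; 4; 2; 3; 2; 1]) _ h1 h2 h3).
Qed.

Lemma subseq_consP (x : T) s X : subseq (x :: s) X ->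
  exists X1 X2, [/\ X = X1 ++ x :: X2, x \notin X1 & subseq s X2].
Proof.
elim: X => //= y X IH; case: eqP => [->|/eqP xy] h.
  by exists [::], X.
have [X1 [X2 [-> h2 h3]]] := IH h.
by exists (y :: X1), X2; split=> //; rewrite inE (negPf xy).
Qed.

(** A sock of [q] falls somewhere among the links. The links before it are discarded, and the
    preceding chain color, which has occurred already, supplies a first link for [q]; if [q] comes
    after the final [a], then [a q] is a chain by itself. *)
Lemma chain_insert a t ts q U V : q != a -> t \in U -> q \in V ->
    subseq (chain a t ts) V ->
  exists2 ts', {subset ts' <= t :: ts} & subseq (chain a q ts') (U ++ V).
Proof.
move=> qa tU qV sub.
have [->|qt] := eqVneq q t.
  by exists ts; [move=> x xt; rewrite inE xt orbT | exact: sub_catr].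
elim: ts t U V tU qV qt sub => [|u ts IH] t U V tU qV qt.
  case/subseq_consP => V0 [V1 [eV aV sub]]; move: qV; rewrite eV.
  rewrite mem_cat inE (negPf qa) => /orP[q0|q1].
    exists [:: t]; first by move=> x; rewrite inE => ->; rewrite ?inE.
    by rewrite /= sub_head // sub_head // sub_cons.
  by exists [::] => //; rewrite /= sub_catr // sub_catr // sub_cons // sub1seq.
case/subseq_consP => V0 [V1 [eV uV /subseq_consP[V2 [V3 [eV1 tV2 sub]]]]].
have sUts : {subset u :: ts <= [:: t, u & ts]} by move=> x hx; rewrite in_cons hx orbT.
have [eq_qu|qu] := eqVneq q u.
  exists ts; first by move=> x hx; apply: sUts; rewrite inE hx orbT.
  apply: sub_catr; rewrite eV eV1 eq_qu; apply: sub_catr.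
  apply: subseq_trans (subseq_cons _ _); apply: sub_catr.
  exact: subseq_trans sub (subseq_cons _ _).
move: qV; rewrite eV eV1 mem_cat inE (negPf qu) mem_cat inE (negPf qt) /=.
case/or3P => [q0|q2|q3].
- exists [:: t, u & ts] => //=.
  rewrite sub_head // sub_head // sub_cons // sub_catr // sub_cons //.
- exists (u :: ts) => //=.
  rewrite sub_catr // sub_catr // sub_cons // sub_head //.
  exact: subseq_trans sub (subseq_cons _ _).
have [||||ts' h1 h2] := IH u (U ++ V0 ++ u :: V2 ++ [:: t]) V3 => //.
  by rewrite !mem_cat inE eqxx !orbT.
exists ts'; first by move=> x /h1/sUts.
by move: h2; rewrite -!catA /= -!catA.
Qed.

(** A sock of the separator [b] before the first link gives the first alternative, and one inside
    that link a word of [I_{2,n}]. If it comes later, induct on the rest of the chain, whose first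
    alternative becomes a word of [I_{3,n}] for the whole chain. Only a chain without links, with
    [b] after its [a], stays undecided. *)
Lemma chain_meet a b t ts P V : uniq [:: a; b; t] -> b \notin ts ->
    uniq (a :: t :: ts) -> subseq [:: a; b; t] P -> b \in V ->
    subseq (chain a t ts) V ->
  [\/ subseq (b :: chain a t ts) V, has_Gamma (P ++ V) |
      ts = [::] /\ (subseq [:: a; b; t] V \/ subseq [:: a; t; b] V)].
Proof.
elim: ts t P V => [|u ts IH] t P V u3 bts uts sP bV.
  case/subseq_consP => V0 [V1 [eV aV]]; rewrite sub1seq => tV1.
  move: u3; rewrite /= !inE !negb_or andbT => /andP[/andP[ab at_] bt].
  move: bV; rewrite eV mem_cat inE [b == a]eq_sym (negPf ab) => /orP[b0|b1].
    by apply: Or31; rewrite sub_head // sub_cons // sub1seq.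
  have [V2 [V3 [eV1 _ _]]] : exists V2 V3, [/\ V1 = V2 ++ t :: V3, t \notin V2 & subseq [::] V3].
    by apply: subseq_consP; rewrite sub1seq.
  apply: Or33; split=> //.
  move: b1; rewrite eV1 mem_cat inE (negPf bt) /= => /orP[b2|b3]; [left|right].
    by rewrite sub_catr // sub_cons // sub_head // sub_cons // sub0seq.
  apply: sub_catr; apply: sub_cons; apply: sub_catr; apply: sub_cons.
  by rewrite sub1seq.
case/subseq_consP => V0 [V1 [eV uV /subseq_consP[V2 [V3 [eV1 tV2 sub]]]]].
move: u3 (bts) (uts); rewrite /= !inE !negb_or andbT => /andP[/andP[ab at_] bt].
case/andP => bu bts' /and3P[/and3P[_ au ats] /andP[tu tts] /andP[uts' ut]].
move: bV; rewrite eV eV1 mem_cat inE (negPf bu) mem_cat inE (negPf bt) /=.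
case/or3P => [b0|b2|b3].
- apply: Or31; rewrite sub_head // sub_cons // sub_catr // sub_cons //.
- apply: Or32; apply: (@Gamma_I2 a t b u ts) => //.
    by rewrite /= !inE !negb_or ab at_ au bu tu [t == b]eq_sym bt.
  rewrite -[_ ++ chain _ _ _]/([:: a; b; t] ++ u :: b :: t :: chain a u ts).
  by rewrite cat_subseq // sub_catr // sub_cons // sub_head // sub_cons.
have eX : P ++ V0 ++ u :: V2 ++ t :: V3 = (P ++ V0 ++ u :: V2 ++ [:: t]) ++ V3.
  by rewrite -!catA /= -!catA.
have [||||||b1|G|[ets [b1|b1]]] := IH u (P ++ V0 ++ u :: V2 ++ [:: t]) V3 => //.
- by rewrite /= !inE !negb_or ab au bu.
- by rewrite /= inE negb_or au ats uts' ut.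
- rewrite -[[:: a; b; u]]/([:: a; b] ++ [:: u]) cat_subseq //.
    by apply: subseq_trans sP; rewrite /= !eqxx.
  by rewrite sub_catr // sub_cons // sub0seq.
- apply: Or32; apply: (@Gamma_I3 a b t u ts) => //.
    by rewrite /= !inE !negb_or ab at_ au bu tu bt.
  rewrite -[_ ++ chain _ _ _]/([:: a; b; t] ++ u :: t :: b :: chain a u ts).
  by rewrite cat_subseq // sub_catr // sub_cons // sub_catr // sub_cons.
- by apply: Or32; rewrite eX.
- apply: Or32; apply: (@Gamma_I1 b t a u [::]) => //.
    by rewrite /= !inE !negb_or bt bu ![_ == a]eq_sym ab at_ au tu.
  rewrite -[_ ++ chain _ _ _]/([:: a; b; t] ++ u :: [:: a; b; u]).
  rewrite cat_subseq // sub_catr // sub_cons // sub_catr //.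
  exact: subseq_trans b1 (subseq_cons _ _).
apply: Or32; apply: obs_nil.
check_obs a [:: a; b; t; u]
  [:: (0, 1); (0, 2); (0, 3); (1, 2); (1, 3); (2, 3)] (@nil (nat * nat)) (@nil (seq nat))
  [:: [:: [:: 0; 1; 2]]; [:: [:: 3]]; [:: [:: 2]]; [:: [:: 0; 3; 1]]]
  [:: P; V0 ++ [:: u]; V2 ++ [:: t]; V3].
Qed.

End Chains.

Ltac distinct := rewrite /= ?inE ?negb_or; repeat (apply/andP; split) => //;
  solve [ assumption | rewrite eq_sym; assumption ].

Lemma sub_drop (T : eqType) (x : T) s X : subseq s X -> subseq s (x :: X).
Proof. by move=> h; apply: subseq_trans h (subseq_cons _ _). Qed.

Ltac sublist := first [ exact: sub0seq | apply: sub_cons; sublist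
  | apply: sub_drop; sublist ].

Ltac sub_of sub := refine (subseq_trans _ sub); sublist.

(** * Chains and short obstructions that appear after [z] is output *)

Section Choice.
Variable T : eqType.
Implicit Types (a b t u : T) (ts S R U V W X : seq T).

Lemma chain_links_notin a t ts V z : subseq (chain a t ts) V -> z \notin V ->
  z \notin ts.
Proof. by move=> h; apply: contra => /(chain_links_mem a t)/(mem_subseq h). Qed.

Lemma subseq_insert (z : T) r s W : z \notin s -> subseq s W ->
    subseq (z :: r) W ->
  (exists2 k, k < size s & subseq (take k s ++ z :: drop k s) W) \/
  subseq (s ++ z :: r) W.
Proof.
move=> zs sW /subseq_consP[W1 [W2 [eW zW1 rW2]]].
move: sW; rewrite eW => /subseq_catP[k ks /andP[h1 h2]].
have {}h2 : subseq (drop k s) W2.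
  move: h2; case e: (drop k s) => [|x s'] /=; first by rewrite sub0seq.
  have /negPf -> // : x != z.
  by apply: contra zs => /eqP <-; apply: (mem_drop (n0 := k)); rewrite e mem_head.
move: ks; rewrite leq_eqVlt => /orP[/eqP ek|ks]; [right|left].
  by move: h1; rewrite ek take_size => h1; rewrite cat_subseq // sub_cons.
by exists k => //; rewrite cat_subseq // sub_cons.
Qed.

Section Fixed.
Variables (W V : seq T) (z : T).
Hypothesis zV : z \notin V.
Let X := W ++ z :: V.

Lemma chain_inner a b t ts : uniq [:: a; b; t; z] -> uniq (a :: t :: ts) ->
    subseq [:: a; b; z; t] W -> b \notin ts -> b \in V ->
    subseq (chain a t ts) V ->
  has_Gamma X.
Proof.
move=> u4 uts sW bts bV sV.
have zts := chain_links_notin sV zV.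
move: u4; rewrite /= !inE !negb_or !andbT.
case/and3P => /and3P[ab at_ az] /andP[bt bz] tz.
have sW' : subseq [:: a; b; t] W.
  by sub_of sW.
have [|h|h|[ets h]] := @chain_meet _ a b t ts W V _ bts uts sW' bV sV.
- by distinct.
- apply: (@Gamma_I3 _ a b z t ts) => //; first by distinct.
  rewrite -[_ ++ chain _ _ _]/([:: a; b; z; t] ++ z :: b :: chain a t ts).
  by rewrite cat_subseq // sub_cons.
- apply: has_Gamma_subseq h; rewrite cat_subseq //; exact: subseq_cons.
apply: obs_nil; case: h => h.
  check_obs a [:: a; b; t; z]
    [:: (0, 1); (0, 2); (0, 3); (1, 2); (1, 3); (2, 3)] (@nil (nat * nat)) (@nil (seq nat))
    [:: [:: [:: 0; 1; 3; 2]]; [:: [:: 3]]; [:: [:: 0; 1; 2]]] [:: W; [:: z]; V].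
check_obs a [:: a; b; t; z]
  [:: (0, 1); (0, 2); (0, 3); (1, 2); (1, 3); (2, 3)] (@nil (nat * nat)) (@nil (seq nat))
  [:: [:: [:: 0; 1; 3; 2]]; [:: [:: 3]]; [:: [:: 0; 2; 1]]] [:: W; [:: z]; V].
Qed.

(** The place of the first [z] decides the family: [I_{1,n}] before [a], [I_{2,n}] between [a] and
    [b], and [I_{3,n}], through [chain_inner], between [b] and [t]. After [t], the sock [d] behind
    [z] gives [I_{4,n}] if it is [t] and [I_{5,n}] if it is new; if it is a link, the chain that
    starts at [d] leads back to [chain_inner]. The undecided cases of [chain_meet] are small enough
    to be computed. *)
Lemma chain_live a b t ts d : uniq [:: a; b; t; z] ->
    subseq [:: a; b; t] W -> b \notin ts -> b \in V ->
    subseq (chain a t ts) V -> z != d -> subseq [:: z; d] W ->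
    ~~ subseq [:: a; b; a] W -> ~~ subseq [:: b; t; b] W ->
  has_Gamma X.
Proof.
move=> u4 sW bts bV sV zd zdW aba btb.
have at_ : a != t by move: u4; rewrite /= !inE !negb_or => /and4P[/and3P[]].
have {ts bts sV} [ts [uts bts sV]] : exists ts,
    [/\ uniq (a :: t :: ts), b \notin ts & subseq (chain a t ts) V].
  have [ts' [h1 h2 h3]] := chain_uniq at_ sV.
  by exists ts'; split=> //; apply: contra bts; exact: h2.
have zts := chain_links_notin sV zV.
have u4' := u4; move: u4; rewrite /= !inE !negb_or !andbT.
case/and3P => /and3P[ab _ az] /andP[bt bz] tz.
have z3 : z \notin [:: a; b; t].
  by rewrite !inE !negb_or ![z == _]eq_sym az bz tz.
case: (subseq_insert z3 sW zdW) => [[[|[|[|k]]] //= _ h]|h].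
- apply: (@Gamma_I1 _ a b z t ts) => //; first by distinct.
  rewrite -[_ ++ chain _ _ _]/([:: z; a; b; t] ++ z :: chain a t ts).
  by rewrite cat_subseq // sub_cons.
- have [|h'|h'|[ets h']] := @chain_meet _ a b t ts W V _ bts uts sW bV sV.
  + by distinct.
  + apply: (@Gamma_I2 _ a b z t ts) => //; first by distinct.
    rewrite -[_ ++ chain _ _ _]/([:: a; z; b; t] ++ z :: b :: chain a t ts).
    by rewrite cat_subseq // sub_cons.
  + apply: has_Gamma_subseq h'; rewrite cat_subseq //; exact: subseq_cons.
  apply: obs_nil; case: h' => h'.
    check_obs a [:: a; b; t; z]
      [:: (0, 1); (0, 2); (0, 3); (1, 2); (1, 3); (2, 3)] (@nil (nat * nat)) (@nil (seq nat))
      [:: [:: [:: 0; 3; 1; 2]]; [:: [:: 3]]; [:: [:: 0; 1; 2]]] [:: W; [:: z]; V].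
  check_obs a [:: a; b; t; z]
    [:: (0, 1); (0, 2); (0, 3); (1, 2); (1, 3); (2, 3)] (@nil (nat * nat)) (@nil (seq nat))
    [:: [:: [:: 0; 3; 1; 2]]; [:: [:: 3]]; [:: [:: 0; 2; 1]]] [:: W; [:: z]; V].
- exact: (chain_inner u4' uts h bts bV sV).
have da : d != a by apply: contra aba => /eqP da; rewrite -{2}da; sub_of h.
have db : d != b by apply: contra btb => /eqP db; rewrite -{2}db; sub_of h.
have [dts|dts] := boolP (d \in ts).
  case/splitPr: dts uts bts sV {zts} => p s uts bts sV.
  apply: (@chain_inner a b d s) => //.
  - by distinct.
  - move: uts; apply: subseq_uniq; apply: sub_cons; apply: sub_drop.
    exact: suffix_subseq.
  - by sub_of h.
  - by apply: contra bts; rewrite mem_cat inE => ->; rewrite !orbT.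
  - exact: subseq_trans (chain_suffix a t d p s) sV.
have [|h'|h'|[ets h']] := @chain_meet _ a b t ts W V _ bts uts sW bV sV.
- by distinct.
- have [dt|dt] := eqVneq d t.
    apply: (@Gamma_I4 _ a b z t ts) => //; first by distinct.
    rewrite -[_ ++ chain _ _ _]/([:: a; b; t; z; t] ++ b :: chain a t ts).
    by rewrite cat_subseq //; [rewrite -{2}dt | apply: sub_drop].
  apply: (@Gamma_I5 _ a b z d t ts) => //; first by distinct.
    by rewrite !inE !negb_or da db [d == z]eq_sym zd dt dts.
  rewrite -[_ ++ chain _ _ _]/([:: a; b; t; z; d] ++ z :: b :: chain a t ts).
  by rewrite cat_subseq // sub_cons.
- apply: has_Gamma_subseq h'; rewrite cat_subseq //; exact: subseq_cons.
apply: obs_nil; case: h' => h'.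
  check_obs a [:: a; b; t; z; d]
    [:: (0, 1); (0, 2); (0, 3); (1, 2); (1, 3); (2, 3); (3, 4); (4, 0); (4, 1)]
    (@nil (nat * nat)) (@nil (seq nat))
    [:: [:: [:: 0; 1; 2; 3; 4]]; [:: [:: 3]]; [:: [:: 0; 1; 2]]] [:: W; [:: z]; V].
check_obs a [:: a; b; t; z; d]
  [:: (0, 1); (0, 2); (0, 3); (1, 2); (1, 3); (2, 3); (3, 4); (4, 0); (4, 1)]
    (@nil (nat * nat)) (@nil (seq nat))
  [:: [:: [:: 0; 1; 2; 3; 4]]; [:: [:: 3]]; [:: [:: 0; 2; 1]]] [:: W; [:: z]; V].
Qed.

Lemma kept_clustered (P : pred T) a b : clustered (filter P W) -> a != b ->
  a \in filter P W -> b \in filter P W -> ~~ subseq [:: a; b; a] W.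
Proof.
move=> /clusteredP cl /eqP ab; rewrite !mem_filter => /andP[Pa _] /andP[Pb _].
by have := cl a b ab; rewrite subseq_filter /= Pa Pb.
Qed.

(** Short obstructions need no care in the selection of [z]: its first sock lies before, inside or
    after [a b], and each of the four patterns then yields a word of Gamma. In the last position the
    sock [e], which separates this sock from the last [z], is used as well. *)
Lemma short_Gamma (P : pred T) e : clustered (filter P W) ->
    z != e -> subseq [:: z; e] W -> short_obs (filter P W) V ->
  has_Gamma X.
Proof.
move=> cl ze zeW [a [b [c [u3 abK pat]]]].
have nz x : x \in V -> x != z by move=> xV; apply: contra zV => /eqP <-.
move: u3; rewrite /= !inE !negb_or !andbT => /andP[/andP[ab ac] bc].
have [aV [bV cV]] : a \in V /\ b \in V /\ c \in V.
  case: pat => [h|h|h|[d _ h]]; do !split; apply: (mem_subseq h);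
    by rewrite !inE eqxx ?orbT.
have abW : subseq [:: a; b] W by apply: subseq_trans abK (filter_subseq _ _).
have aba : ~~ subseq [:: a; b; a] W.
  by apply: (kept_clustered cl) => //; apply: (mem_subseq abK); rewrite !inE eqxx ?orbT.
have az := nz a aV; have bz := nz b bV; have cz := nz c cV.
have z2 : z \notin [:: a; b] by rewrite !inE !negb_or ![z == _]eq_sym az bz.
have heads3 : [\/ subseq [:: z; a; b] W, subseq [:: a; z; b] W |
    e != a /\ subseq [:: a; b; z; e] W].
  case: (subseq_insert z2 abW zeW) => [[[|[|k]] //= _ h]|h].
  - exact: Or31.
  - exact: Or32.
  apply: Or33; split=> //.
  by apply: contra aba => /eqP ea; rewrite -{2}ea; sub_of h.
pose no := @nil (nat * nat).
pose neq := [:: (0, 1); (0, 2); (0, 3); (1, 2); (1, 3); (2, 3)].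
apply: obs_nil; case: heads3 => [h|h|[ea h]];
  case: pat => [pat|pat|pat|[d /[!inE] /[!negb_or] /and3P[da db dc] pat]].
- check_obs a [:: a; b; c; z] neq no (@nil (seq nat))
    [:: [:: [:: 3; 0; 1]]; [:: [:: 3]]; [:: [:: 0; 2; 0; 1]]] [:: W; [:: z]; V].
- check_obs a [:: a; b; c; z] neq no (@nil (seq nat))
    [:: [:: [:: 3; 0; 1]]; [:: [:: 3]]; [:: [:: 2; 0; 1; 2]]] [:: W; [:: z]; V].
- check_obs a [:: a; b; c; z] neq no (@nil (seq nat))
    [:: [:: [:: 3; 0; 1]]; [:: [:: 3]]; [:: [:: 2; 0; 2; 1]]] [:: W; [:: z]; V].
- have dz : d != z by apply: nz; apply: (mem_subseq pat); rewrite !inE eqxx ?orbT.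
  check_obs a [:: a; b; c; z; d] (neq ++ [:: (4, 0); (4, 1); (4, 2); (4, 3)])
    no (@nil (seq nat))
    [:: [:: [:: 3; 0; 1]]; [:: [:: 3]]; [:: [:: 0; 2; 4; 2; 1]]] [:: W; [:: z]; V].
- check_obs a [:: a; b; c; z] neq no (@nil (seq nat))
    [:: [:: [:: 0; 3; 1]]; [:: [:: 3]]; [:: [:: 0; 2; 0; 1]]] [:: W; [:: z]; V].
- check_obs a [:: a; b; c; z] neq no (@nil (seq nat))
    [:: [:: [:: 0; 3; 1]]; [:: [:: 3]]; [:: [:: 2; 0; 1; 2]]] [:: W; [:: z]; V].
- check_obs a [:: a; b; c; z] neq no (@nil (seq nat))
    [:: [:: [:: 0; 3; 1]]; [:: [:: 3]]; [:: [:: 2; 0; 2; 1]]] [:: W; [:: z]; V].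
- have dz : d != z by apply: nz; apply: (mem_subseq pat); rewrite !inE eqxx ?orbT.
  check_obs a [:: a; b; c; z; d] (neq ++ [:: (4, 0); (4, 1); (4, 2); (4, 3)])
    no (@nil (seq nat))
    [:: [:: [:: 0; 3; 1]]; [:: [:: 3]]; [:: [:: 0; 2; 4; 2; 1]]] [:: W; [:: z]; V].
- check_obs a [:: a; b; c; z; e] (neq ++ [:: (4, 0); (3, 4)]) no (@nil (seq nat))
    [:: [:: [:: 0; 1; 3; 4]]; [:: [:: 3]]; [:: [:: 0; 2; 0; 1]]] [:: W; [:: z]; V].
- check_obs a [:: a; b; c; z; e] (neq ++ [:: (4, 0); (3, 4)]) no (@nil (seq nat))
    [:: [:: [:: 0; 1; 3; 4]]; [:: [:: 3]]; [:: [:: 2; 0; 1; 2]]] [:: W; [:: z]; V].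
- check_obs a [:: a; b; c; z; e] (neq ++ [:: (4, 0); (3, 4)]) no (@nil (seq nat))
    [:: [:: [:: 0; 1; 3; 4]]; [:: [:: 3]]; [:: [:: 2; 0; 2; 1]]] [:: W; [:: z]; V].
have dz : d != z by apply: nz; apply: (mem_subseq pat); rewrite !inE eqxx ?orbT.
check_obs a [:: a; b; c; z; d; e]
  (neq ++ [:: (4, 0); (4, 1); (4, 2); (4, 3); (5, 0); (3, 5)]) no (@nil (seq nat))
  [:: [:: [:: 0; 1; 3; 5]]; [:: [:: 3]]; [:: [:: 0; 2; 4; 2; 1]]] [:: W; [:: z]; V].
Qed.

End Fixed.
End Choice.

(** * Selecting the next color *)

Section Returning.
Variable T : eqType.
Implicit Types (S R U V W X p s : seq T).

Definition returning X (x : T) :=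
  has (fun d => (x != d) && subseq [:: x; d; x] X) X.

Lemma returningP X x :
  reflect (exists2 d, x != d & subseq [:: x; d; x] X) (returning X x).
Proof.
apply: (iffP hasP) => [[d _ /andP[h1 h2]]|[d h1 h2]]; first by exists d.
by exists d; rewrite ?h1 ?h2 //; apply: (mem_subseq h2); rewrite !inE eqxx orbT.
Qed.

Lemma returningN X x d : ~~ returning X x -> x != d -> ~~ subseq [:: x; d; x] X.
Proof. by move=> /returningP h xd; apply/negP => hs; apply: h; exists d. Qed.

Lemma returning_simple (X : seq T) x d : ~~ returning X x -> x != d ->
  subseq [:: x; d; x] X -> False.
Proof. by move=> h1 h2; apply/negP/returningN. Qed.

Lemma last_occurrence (x : T) V : x \in V ->
  exists A B, V = A ++ x :: B /\ x \notin B.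
Proof.
elim: V => // v V IH; have [/IH[A [B [-> h]]] _|xV] := boolP (x \in V).
  by exists (v :: A), B.
by rewrite inE (negPf xV) orbF => /eqP e; exists [::], V; rewrite -e.
Qed.

(* The socks of color [v] are adjacent in [W]. *)
Lemma subseq_glue (v : T) p s W : ~~ returning W v -> v \notin p -> v \notin s ->
  subseq (rcons p v) W -> subseq (v :: s) W -> subseq (p ++ v :: s) W.
Proof.
elim: W p => [|y W IH] [|x p] // nr vp vs.
have nr' : ~~ returning W v.
  by apply: contra nr => /returningP[d h1 h2]; apply/returningP; exists d => //; exact: sub_drop.
move: vp; rewrite inE negb_or => /andP[vx vp].
rewrite rcons_cons /=; case: (eqVneq x y) => [<-|xy].
  by rewrite (negPf vx) => h1 h2; apply: IH.
case: (eqVneq v y) => [vy|vy] h1 h2; last first.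
  by apply: (IH (x :: p)) => //; rewrite inE negb_or vx.
case: (returning_simple nr vx); rewrite -vy; apply: sub_cons.
apply: subseq_trans h1; rewrite /= eqxx -cats1; exact: suffix_subseq.
Qed.

(** Since the socks of [v] are adjacent in [W], being before or after [v] means the same for each of
    them. *)
Lemma simple_split (v : T) W : ~~ returning W v -> v \in W ->
  exists W1 W2, [/\ W = W1 ++ v :: W2, v \notin W1,
    forall p, v \notin p -> subseq (rcons p v) W -> subseq p W1 &
    forall s, v \notin s -> subseq (v :: s) W -> subseq s W2].
Proof.
move=> nr; rewrite -sub1seq => /subseq_consP[W1 [W2 [eW vW1 _]]].
exists W1, W2; split=> // [p vp|s vs]; rewrite eW; last first.
  case/subseq_consP => A [B [eAB vA sB]].
  suff -> : W2 = B by [].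
  elim: W1 A vW1 vA eAB {eW nr} => [|x W1 IH] [|y A]; rewrite /= ?inE ?negb_or.
  - by move=> _ _ [].
  - by move=> _ /andP[/eqP vy _] [/vy].
  - by move=> /andP[/eqP vx _] _ [/esym/vx].
  by move=> /andP[_ h1] /andP[_ h2] [_]; apply: IH.
case/subseq_catP => k ks /andP[h1 h2].
have [kp|kp] := leqP (size p) k.
  apply: subseq_trans h1; rewrite -cats1.
  by rewrite take_cat ltnNge kp /=; exact: prefix_subseq.
have e : drop k (rcons p v) = rcons (drop k p) v by rewrite drop_rcons // ltnW.
move: h2; rewrite e; case ed: (drop k p) => [|x s].
  by move: (congr1 size ed); rewrite size_drop /= => /eqP; rewrite subn_eq0 leqNgt kp.
have vx : v != x.
  by apply: contra vp => /eqP->; apply: (mem_drop (n0 := k)); rewrite ed mem_head.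
rewrite rcons_cons /= eq_sym (negPf vx) => h2.
case: (returning_simple nr vx); rewrite eW; apply: sub_catr; apply: sub_cons.
apply: subseq_trans h2; rewrite /= eqxx -cats1; exact: suffix_subseq.
Qed.

Definition top S q := (q \in S) && all (fun v => (q == v) || ~~ subseq [:: q; v] S) S.

Lemma topP S q v : top S q -> q != v -> ~~ subseq [:: q; v] S.
Proof.
case/andP => _ /allP h qv; apply/negP => hs.
have /h : v \in S by apply: (mem_subseq hs); rewrite !inE eqxx orbT.
by rewrite (negPf qv) hs.
Qed.

Lemma top_after S q s : top S q -> q \notin s -> subseq s S -> subseq (rcons s q) S.
Proof.
move=> tq qs sS; have qS : subseq [:: q] S by rewrite sub1seq; case/andP: tq.
case: (subseq_insert qs sS qS) => [[k ks h]|]; last by rewrite cats1.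
have qx : q != nth q s k by apply: contra qs => /eqP->; exact: mem_nth.
case/negP: (topP tq qx); apply: subseq_trans h; apply: sub_catr.
by rewrite (drop_nth q ks); sublist.
Qed.

Lemma top_rcons S q : clustered (rcons S q) -> top (rcons S q) q.
Proof.
move=> cl; rewrite /top mem_rcons mem_head; apply/allP => v _.
have [//|/eqP qv /=] := eqVneq q v.
move/clusteredP: cl => /(_ _ _ qv); apply: contra => h.
rewrite -cats1 in h *; case/subseq_catP: h => -[|[|k]] _ /andP[h1 h2].
- by have := size_subseq h2.
- by move: h2; rewrite [drop _ _]/= sub1seq inE => /eqP/esym/qv.
by rewrite -[[:: q; v; q]]/([:: q; v] ++ [:: q]) cat_subseq.
Qed.

Lemma top_eq S q v : top S q -> q != v -> v \in S -> subseq [:: v; q] S.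
Proof.
by move=> tq qv vS; apply: (top_after (s := [:: v])); rewrite ?inE ?sub1seq.
Qed.

(* Simple colors that may be popped at once when [z] is the next color to be
   output: no returning color lies between the first [z] and them. *)
Definition dropped S U V z w :=
  let X := S ++ U ++ z :: V in
  [&& ~~ returning X w, w \notin S, w \notin V &
      ~~ has (fun h => [&& returning X h, h != z & subseq [:: z; h; w] (S ++ U)])
             (S ++ U)].

Definition keep S U V z w := (w != z) && ~~ dropped S U V z w.
Definition kept S U V z := filter (keep S U V z) (S ++ U).

Lemma dropped_returning S U V z h w : h != z -> returning (S ++ U ++ z :: V) h ->
  subseq [:: z; h; w] (S ++ U) -> ~~ dropped S U V z w.
Proof.
move=> hz hr sub; apply/and4P => -[_ _ _ /negP]; apply; apply/hasP; exists h.
  by apply: (mem_subseq sub); rewrite !inE eqxx orbT.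
by rewrite hr hz sub.
Qed.

Lemma not_dropped S U V z w : ~~ dropped S U V z w ->
    ~~ returning (S ++ U ++ z :: V) w -> w \notin S -> w \notin V ->
  exists h, [/\ returning (S ++ U ++ z :: V) h, h != z & subseq [:: z; h; w] (S ++ U)].
Proof.
rewrite /dropped => + nr wS wV; rewrite nr wS wV negbK => /hasP[h _ /and3P[]].
by exists h.
Qed.

Lemma keep_returning S U V z h : h != z -> returning (S ++ U ++ z :: V) h ->
  keep S U V z h.
Proof. by move=> hz hr; rewrite /keep hz /dropped hr. Qed.

(** * Sortability and obstructions before and after the output of [z] *)

Section Choice.
Variables (S U V : seq T) (z : T).
Let W := S ++ U.
Let X := S ++ U ++ z :: V.
Hypotheses (clS : clustered S) (zV : z \notin V) (zr : returning X z).

Lemma mem_kept x : (x \in kept S U V z) = keep S U V z x && (x \in W).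
Proof. exact: mem_filter. Qed.

Lemma WX s : subseq s W -> subseq s X.
Proof. by move=> h; apply: subseq_trans h _; rewrite /X catA prefix_subseq. Qed.

(** What has to be excluded is [z v w] with [w] output before [z] and [v] after it. A returning [v]
    prevents [w] from being dropped. If [v] is simple, then some returning [h] between [z] and [v]
    prevented [v] from being dropped, and as the socks of [v] are adjacent, [h] also comes before
    [w]. *)
Lemma sortable_choice : (z \in S -> top S z) -> sortable (kept S U V z) V ->
  sortable S (U ++ z :: V).
Proof.
move=> topz; apply: sortable_act => //.
- by rewrite /dropped -/X zr.
- move=> v /eqP zv; apply/negP => h; have zS : z \in S.
    by apply: (mem_subseq h); rewrite mem_head.
  by case/negP: (topP (topz zS) zv).
- move=> w /and4P[wr wS wV _]; split=> // d /eqP wd; apply/negP => /WX.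
  exact: returning_simple wr wd.
move=> v w Dw nDv /eqP zv; apply/negP => sub.
have [vr|vr] := boolP (returning X v).
  by move: Dw; rewrite (negPf (dropped_returning _ vr sub)) // eq_sym.
have [wr wS wV _] := and4P Dw.
have zvU : subseq [:: v; w] U.
  case/subseq_catP: sub => -[|[|k]] _ /andP[h1 h2].
  - by apply: subseq_trans h2; apply: sub_drop.
  - by [].
  have zS : z \in S by apply: (mem_subseq h1); rewrite mem_head.
  case/negP: (topP (topz zS) zv).
  by apply: subseq_trans h1; rewrite /= !eqxx sub0seq.
have zvW : subseq [:: z; v] W by sub_of sub.
have vz : v != z by rewrite eq_sym.
have vS : v \notin S.
  apply/negP => vS; apply: (returning_simple vr vz).
  have [zS|zS] := boolP (z \in S).
    rewrite /X -[[:: v; z; v]]/([:: v; z] ++ [:: v]) cat_subseq ?(top_eq (topz zS)) //.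
    rewrite sub1seq mem_cat; apply/orP; left.
    by apply: (mem_subseq zvU); rewrite mem_head.
  rewrite /X; apply: sub_head => //; apply: subseq_trans (prefix_subseq _ _).
  case/subseq_catP: zvW => -[|k] _ /andP[h1 h2] //.
  by case/negP: zS; apply: (mem_subseq h1); rewrite mem_head.
have vV : v \notin V.
  apply/negP => vV; apply: (returning_simple vr vz).
  rewrite /X; apply: sub_catr; apply: sub_head.
    by apply: (mem_subseq zvU); rewrite mem_head.
  by apply: sub_cons; rewrite sub1seq.
have [h [hr hz subh]] := not_dropped nDv vr vS vV.
have vh : v != h by apply: contra vr => /eqP->.
have wv : w != v by apply: contraNneq nDv => <-.
have nrW : ~~ returning W v.
  apply: contra vr => /returningP[d d1 d2]; apply/returningP; exists d => //.
  exact: WX.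
have sub' : subseq ([:: z; h] ++ [:: v; w]) W.
  apply: subseq_glue => //; rewrite ?inE ?negb_or ?vz ?vh //; first by rewrite eq_sym.
  by sub_of sub.
have : subseq [:: z; h; w] W by sub_of sub'.
by move/(dropped_returning hz hr); rewrite Dw.
Qed.

Lemma returning_next : exists2 e, z != e & subseq [:: z; e] W.
Proof.
have [e ze] := returningP _ _ zr; rewrite /X catA => /subseq_catP[k _ /andP[h1 h2]].
exists e => //; case: k h1 h2 => [|[|k]] h1 h2; last first.
- by apply: subseq_trans h1; rewrite /= !eqxx sub0seq.
- move: h2; rewrite /= eq_sym (negPf ze) => h2.
  by case/negP: zV; apply: (mem_subseq h2); rewrite !inE eqxx orbT.
move: h2; rewrite /= eqxx => h2.
by case/negP: zV; apply: (mem_subseq h2); rewrite !inE eqxx orbT.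
Qed.

Hypothesis clK : clustered (kept S U V z).

Lemma kept_keep x : x \in kept S U V z -> x != z.
Proof. by rewrite mem_kept => /andP[/andP[]]. Qed.

Lemma kept_alternate a b : a != b -> a \in kept S U V z -> b \in kept S U V z ->
  subseq [:: a; b; a] W -> False.
Proof. by move=> ab aK bK; apply/negP; apply: (kept_clustered clK). Qed.

Lemma returning_kept x : x != z -> returning X x -> x \in W -> x \in kept S U V z.
Proof. by move=> xz xr xW; rewrite mem_kept xW keep_returning. Qed.

Lemma chain_before a b t ts : uniq [:: a; b; t] -> z \notin [:: a; b; t] ->
    b \notin ts -> subseq [:: z; a; b; t] W -> subseq (chain a t ts) V ->
  has_Gamma X.
Proof.
rewrite /= !inE !negb_or !andbT => /andP[/andP[ab at_] bt] /and3P[za zb zt].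
move=> bts sub sV; apply: (@Gamma_I1 _ a b z t ts) => //; first by distinct.
  exact: chain_links_notin sV zV.
rewrite -[_ ++ chain _ _ _]/([:: z; a; b; t] ++ z :: chain a t ts) /X catA.
by rewrite cat_subseq // sub_cons.
Qed.

(* The live color [h] separates [a] from [t] as well as [b] does, or takes over
   the role of [a]. *)
Lemma dead_separator a b t ts h W1 W2 : W = W1 ++ b :: W2 ->
    uniq [:: a; b; t] -> subseq [:: a; b; t] (kept S U V z) ->
    a \in W1 -> t \in W2 -> subseq [:: z; h] W1 ->
    h \in kept S U V z -> h \in V -> b \notin V -> b \notin ts ->
    subseq (chain a t ts) V ->
  has_Gamma X.
Proof.
move=> eW u3 abtK aW1 tW2 zhW1 hK hV bV bts sV.
have [aK bK tK] : [/\ a \in kept S U V z, b \in kept S U V z & t \in kept S U V z].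
  by split; apply: (mem_subseq abtK); rewrite !inE eqxx ?orbT.
have u3' := u3; move: u3'; rewrite /= !inE !negb_or !andbT => /andP[/andP[ab at_] bt].
have hz := kept_keep hK; have az := kept_keep aK; have bz := kept_keep bK.
have tz := kept_keep tK; have zts := chain_links_notin sV zV.
have hb : h != b by apply: contraNneq bV => <-.
have zn : z \notin [:: a; b; t] by rewrite !inE !negb_or ![z == _]eq_sym az bz tz.
have za_done : subseq [:: z; a] W1 -> has_Gamma X.
  move=> za; apply: (chain_before u3 zn bts _ sV).
  rewrite eW -[[:: z; a; b; t]]/([:: z; a] ++ [:: b; t]) cat_subseq // sub_cons //.
  by rewrite sub1seq.
have [ah|ah] := eqVneq a h; first by apply: za_done; rewrite ah.
have zna : z \notin [:: a] by rewrite inE eq_sym.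
have saW1 : subseq [:: a] W1 by rewrite sub1seq.
case: (subseq_insert zna saW1 zhW1) => [[k k1 za]|azh]; first by case: k k1 za => // _ /za_done.
have azhbt : subseq ([:: a; z; h] ++ [:: b; t]) W.
  by rewrite eW cat_subseq // sub_cons // sub1seq.
have ht : h != t.
  apply/eqP => ht; case: (kept_alternate _ tK bK); first by rewrite eq_sym.
  by rewrite -{1}ht; sub_of azhbt.
have [hts|hts] := boolP (h \in ts).
  have [p p1 p2] := chain_prefix a t hts.
  apply: (@chain_before h b t p).
  - by distinct.
  - by rewrite !inE !negb_or ![z == _]eq_sym hz bz tz.
  - by apply: contra bts; exact: p1.
  - by sub_of azhbt.
  exact: subseq_trans p2 sV.
have zh : z != h by rewrite eq_sym.
rewrite /X catA; apply: (@chain_live _ W V z zV a h t ts h) => //.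
- by distinct.
- by sub_of azhbt.
- by sub_of azhbt.
- by apply/negP; apply: kept_alternate.
by apply/negP; apply: kept_alternate.
Qed.

(** The chains out of reach of [chain_live], because their separator [b] has no sock in [V]. *)
Definition dead_chain a b t ts :=
  [/\ uniq [:: a; b; t], subseq [:: a; b; t] (kept S U V z), b \notin V,
      b \notin ts & subseq (chain a t ts) V].

(** All obstructions of the smaller state are traced back at once, except dead chains that [z] does
    not precede and that are not already on the stack. What to do with these depends on how [z] was
    selected. *)
Lemma choice_obs : (z \in S -> top S z) -> obs (kept S U V z) V ->
  obs S (U ++ z :: V) \/ exists a b t (ts : seq T),
    [/\ dead_chain a b t ts, ~~ subseq [:: z; a; b; t] W &
        [/\ subseq [:: a; b] S, t \in U & z \notin S] \/ subseq [:: b; t] U].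
Proof.
have KW : subseq (kept S U V z) W by exact: filter_subseq.
have [e ze zeW] := returning_next.
move=> topz [G|[a [b [t [ts [u3 abtK bts sV]]]]]|sh].
- left; apply: Or31; apply: has_Gamma_subseq G; rewrite catA.
  rewrite cat_subseq //; exact: subseq_cons.
- have [aK bK tK] : [/\ a \in kept S U V z, b \in kept S U V z & t \in kept S U V z].
    by split; apply: (mem_subseq abtK); rewrite !inE eqxx ?orbT.
  have u3' := u3; move: u3'; rewrite /= !inE !negb_or !andbT => /andP[/andP[ab at_] bt].
  have az := kept_keep aK; have bz := kept_keep bK; have tz := kept_keep tK.
  have zn : z \notin [:: a; b; t] by rewrite !inE !negb_or ![z == _]eq_sym az bz tz.
  have abtW := subseq_trans abtK KW.
  have [bV|bV] := boolP (b \in V).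
    left; apply: Or31; rewrite catA; apply: (@chain_live _ W V z zV a b t ts e) => //.
    - by distinct.
    - by apply/negP; apply: kept_alternate.
    by apply/negP; apply: kept_alternate.
  have [zW|zW] := boolP (subseq [:: z; a; b; t] W).
    by left; apply: Or31; exact: chain_before zn bts zW sV.
  have case_bU : subseq [:: b; t] U -> obs S (U ++ z :: V) \/ exists a b t (ts : seq T),
    [/\ dead_chain a b t ts, ~~ subseq [:: z; a; b; t] W &
        [/\ subseq [:: a; b] S, t \in U & z \notin S] \/ subseq [:: b; t] U].
    by move=> btU; right; exists a, b, t, ts; split=> //; right.
  case/subseq_catP: abtW => -[|[|[|k]]] _ /andP[h1 h2].
  + by apply: case_bU; apply: subseq_trans h2; exact: sub_drop.
  + exact: case_bU.
  + have tU : t \in U by rewrite -sub1seq.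
    have [zS|zS] := boolP (z \in S); last first.
      by right; exists a, b, t, ts; split=> //; left.
    (* The top [z] takes the place of [t], and [t z] becomes a new first link. *)
    left; apply: Or32; exists a, b, z, (t :: ts); split.
    - by distinct.
    - by apply: (top_after (s := [:: a; b]) (topz zS)); rewrite // !inE negb_or ![z == _]eq_sym az bz.
    - by rewrite inE negb_or bt bts.
    by rewrite /= sub_head // sub_cons.
  left; apply: Or32; exists a, b, t, ts; split=> //.
  by apply: sub_catr; exact: sub_drop.
left; apply: Or31; rewrite catA; exact: short_Gamma clK ze zeW sh.
Qed.

(* The top of the stack may take over the role of [t]. *)
Lemma insert_top a b t ts q : dead_chain a b t ts -> subseq [:: a; b] S -> t \in U ->
  top S q -> q \in V -> obs S (U ++ z :: V).
Proof.
case=> u3 _ bV bts sV abS tU tq qV.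
move: u3; rewrite /= !inE !negb_or !andbT => /andP[/andP[ab at_] bt].
have qa : q != a.
  by apply/eqP => qa; have := @topP S q b tq; rewrite qa ab abS => /(_ isT).
have bq : b != q by apply: contraNneq bV => ->.
have [ts' h1 h2] := chain_insert qa tU qV sV.
apply: Or32; exists a, b, q, ts'; split.
- by distinct.
- by apply: (top_after (s := [:: a; b]) tq); rewrite // !inE negb_or qa eq_sym bq.
- by apply/negP => /h1; rewrite inE (negPf bt) (negPf bts).
by apply: subseq_trans h2 _; rewrite cat_subseq //; exact: subseq_cons.
Qed.

(** A simple separator is kept only because some returning [h] lies between the first [z] and it;
    this [h] is the candidate for [dead_separator]. The separator is not on the stack, as the
    returning top would lie between two of its socks. *)
Lemma simple_separator a b t ts : dead_chain a b t ts -> subseq [:: b; t] U ->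
    ~~ returning X b -> (S <> [::] -> exists2 q, top S q & returning X q) ->
  exists h W1 W2, [/\ returning X h, h != z, W = W1 ++ b :: W2, subseq [:: z; h] W1 &
    a \in W1 /\ t \in W2].
Proof.
case=> u3 abtK bV bts sV btU br qtop.
have [aK bK tK] : [/\ a \in kept S U V z, b \in kept S U V z & t \in kept S U V z].
  by split; apply: (mem_subseq abtK); rewrite !inE eqxx ?orbT.
move: u3; rewrite /= !inE !negb_or !andbT => /andP[/andP[ab at_] bt].
have bU : b \in U by apply: (mem_subseq btU); rewrite mem_head.
have bS : b \notin S.
  apply/negP => bS; have [|q tq qr] := qtop; first by move=> S0; rewrite S0 in bS.
  have bq : b != q by apply: contraNneq br => ->.
  apply: (returning_simple br bq); rewrite /X -[[:: b; q; b]]/([:: b; q] ++ [:: b]).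
  rewrite cat_subseq ?(top_eq tq) //; first by rewrite eq_sym.
  by rewrite sub1seq mem_cat bU.
have nd : ~~ dropped S U V z b by move: bK; rewrite mem_kept => /andP[/andP[]].
have [h [hr hz zhb]] := not_dropped nd br bS bV.
have nrW : ~~ returning W b.
  apply: contra br => /returningP[d d1 d2]; apply/returningP; exists d => //.
  exact: (WX d2).
have bW : b \in W by rewrite mem_cat bU orbT.
have [W1 [W2 [eW _ left_b right_b]]] := simple_split nrW bW.
have KW : subseq (kept S U V z) W by exact: filter_subseq.
have abtW := subseq_trans abtK KW.
exists h, W1, W2; split=> //; last split.
- apply: (left_b [:: z; h] _ zhb); rewrite !inE negb_or (kept_keep bK) /=.
  by apply: contraNneq br => ->.
- by rewrite -sub1seq; apply: (left_b [:: a]); [rewrite inE eq_sym | sub_of abtW].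
by rewrite -sub1seq; apply: (right_b [:: t]); [rewrite inE | sub_of abtW].
Qed.

End Choice.

End Returning.

(** * The case analysis *)

(** The flags say whether the pattern ends too early to place a later sock of letter [i] itself, and
    whether this sock lies in the segment at hand. One script then covers all positions. *)
Definition later (late here : bool) (i : nat) : seq (seq nat) :=
  if late && here then [:: [:: i]] else [::].

Definition located (T : eqType) (x : T) (here : bool) (Y V : seq T) :=
  if here then x \in Y else x \in V.

Section Words.
Variable T : eqType.
Implicit Types (S R U V W Y X p s : seq T).

(* Since [z] and [w] cross, [z] is the only color that can be output first,
   which [f] and [g] forbid. *)
Lemma crossing_words z w y f g W Y V k (b hf hg : bool) :
    z != w -> y != z -> y != w -> f != g -> f != z -> g != z -> k <= 3 ->
    subseq (if b then [:: z; w; z] else [:: w; z; w]) W ->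
    subseq (take k [:: f; g; f]) W -> subseq (drop k [:: f; g; f]) Y ->
    y \in Y -> w \in V -> located f hf Y V -> located g hg Y V ->
  has_Gamma (W ++ Y ++ z :: V).
Proof.
move=> zw yz yw fg fz gz k3 cec h1 h2 yY wV Hf Hg; apply: obs_nil.
pose fgf := [:: 3; 4; 3].
refine (@obs_check _ z [:: z; w; y; f; g]
  [:: (0, 1); (2, 0); (2, 1); (3, 4); (3, 0); (4, 0)] [::] [::]
  [:: [:: if b then [:: 0; 1; 0] else [:: 1; 0; 1]; take k fgf];
      [:: 2] :: drop k fgf :: later (2 < k) hf 3 ++ later (1 < k) hg 4; [:: [:: 0]];
      [:: 1] :: later (2 < k) (~~ hf) 3 ++ later (1 < k) (~~ hg) 4]
  [:: W; Y; [:: z]; V] _ _ _ _ _ _ _ _ _ _).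
- move: k3 {h1 h2 cec Hf Hg}; case: k => [|[|[|[|k]]]] // _; case: hf; case: hg; case: b;
    vm_compute; reflexivity.
- move: k3 {h1 h2 cec Hf Hg}; case: k => [|[|[|[|k]]]] // _; case: hf; case: hg; case: b;
    vm_compute; reflexivity.
- by [].
- by rewrite /= cats0.
- by repeat split; try solve_fact.
- by [].
- by [].
move: k3 h1 h2 cec Hf Hg; case: k => [|[|[|[|k]]]] // _; case: hf; case: hg; case: b;
  move=> h1 h2 cec Hf Hg; repeat split; try solve_fact.
Qed.

(* Here [g] may be simple: it cannot be popped at once, as [z] and [f] precede it. *)
Lemma crossing_words_simple z w y f g W Y V k (b hf : bool) :
    z != w -> y != z -> y != w -> f != g -> f != z -> g != z -> k <= 4 ->
    subseq (if b then [:: z; w; z] else [:: w; z; w]) W ->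
    subseq (take k [:: z; f; g; f]) W -> subseq (drop k [:: z; f; g; f]) Y ->
    y \in Y -> w \in V -> located f hf Y V ->
  has_Gamma (W ++ Y ++ z :: V).
Proof.
move=> zw yz yw fg fz gz k4 cec h1 h2 yY wV Hf; apply: obs_nil.
pose fgf := [:: 0; 3; 4; 3].
refine (@obs_check _ z [:: z; w; y; f; g]
  [:: (0, 1); (2, 0); (2, 1); (3, 4); (3, 0); (4, 0)] [::] [::]
  [:: [:: if b then [:: 0; 1; 0] else [:: 1; 0; 1]; take k fgf];
      [:: 2] :: drop k fgf :: later (3 < k) hf 3; [:: [:: 0]];
      [:: 1] :: later (3 < k) (~~ hf) 3]
  [:: W; Y; [:: z]; V] _ _ _ _ _ _ _ _ _ _).
- move: k4 {h1 h2 cec Hf}; case: k => [|[|[|[|[|k]]]]] // _; case: hf; case: b;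
    vm_compute; reflexivity.
- move: k4 {h1 h2 cec Hf}; case: k => [|[|[|[|[|k]]]]] // _; case: hf; case: b;
    vm_compute; reflexivity.
- by [].
- by rewrite /= cats0.
- by repeat split; try solve_fact.
- by [].
- by [].
move: k4 h1 h2 cec Hf; case: k => [|[|[|[|[|k]]]]] // _; case: hf; case: b;
  move=> h1 h2 cec Hf; repeat split; try solve_fact.
Qed.

Lemma subseq_cons_neq (x y : T) s Y : x != y ->
  subseq (x :: s) (y :: Y) -> subseq (x :: s) Y.
Proof. by rewrite /= => /negPf->. Qed.

Lemma subseq_consE (x y : T) s Y : subseq (x :: s) (y :: Y) ->
  x = y /\ subseq s Y \/ subseq (x :: s) Y.
Proof. by rewrite /=; case: eqP; [left|right]. Qed.

Ltac nested_check c e y f g W V1 V2 neq eqs p r v1 v2 :=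
  check_obs c [:: c; e; y; f; g] neq eqs (@nil (seq nat))
    [:: [:: [:: 2; 0; 1; 0]; p]; [:: [:: 2]]; r :: v1; [:: [:: 0]]; v2]
    [:: W; [:: y]; V1; [:: c]; V2].

(* [e] is simple but cannot be popped at once because of [y] and [c]. *)
Lemma nested_words c e y f g W V1 V2 k :
    c != e -> c != y -> e != y -> f != g -> f != c -> g != c -> e != f -> e != g ->
    k <= 3 -> subseq [:: y; c; e; c] W ->
    subseq (take k [:: f; g; f]) W -> subseq (drop k [:: f; g; f]) (y :: V1) ->
    [\/ f = y, f \in V1 | f \in V2] -> [\/ g = y, g \in V1 | g \in V2] ->
  has_Gamma (W ++ y :: V1 ++ c :: V2).
Proof.
move=> ce cy ey fg fc gc ef eg + ycec.
pose no := @nil (nat * nat); pose none := @nil nat; pose nones := @nil (seq nat).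
pose neq := [:: (0, 1); (0, 2); (1, 2); (3, 4); (3, 0); (4, 0); (1, 3); (1, 4)].
case: k => [|[|[|[|k]]]] // _ h1 h2 Hf Hg; apply: obs_nil.
- case/subseq_consE: h2 => [[fy h2]|h2].
    nested_check c e y f g W V1 V2 neq [:: (3, 2)] none [:: 4; 3] nones nones.
  nested_check c e y f g W V1 V2 neq no none [:: 3; 4; 3] nones nones.
- case/subseq_consE: h2 => [[gy h2]|h2].
    nested_check c e y f g W V1 V2 neq [:: (4, 2)] [:: 3] [:: 3] nones nones.
  nested_check c e y f g W V1 V2 neq no [:: 3] [:: 4; 3] nones nones.
- case/subseq_consE: h2 => [[fy h2]|h2]; case: Hg => Hg.
  + by move: fg; rewrite fy Hg eqxx.
  + nested_check c e y f g W V1 V2 neq [:: (3, 2)] [:: 3; 4] none [:: [:: 4]] nones.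
  + nested_check c e y f g W V1 V2 neq [:: (3, 2)] [:: 3; 4] none nones [:: [:: 4]].
  + nested_check c e y f g W V1 V2 neq [:: (4, 2)] [:: 3; 4] [:: 3] nones nones.
  + nested_check c e y f g W V1 V2 neq no [:: 3; 4] [:: 3] [:: [:: 4]] nones.
  + nested_check c e y f g W V1 V2 neq no [:: 3; 4] [:: 3] nones [:: [:: 4]].
case: Hf => Hf; case: Hg => Hg.
- by move: fg; rewrite Hf Hg eqxx.
- nested_check c e y f g W V1 V2 neq [:: (3, 2)] [:: 3; 4; 3] none [:: [:: 4]] nones.
- nested_check c e y f g W V1 V2 neq [:: (3, 2)] [:: 3; 4; 3] none nones [:: [:: 4]].
- nested_check c e y f g W V1 V2 neq [:: (4, 2)] [:: 3; 4; 3] none [:: [:: 3]] nones.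
- nested_check c e y f g W V1 V2 neq no [:: 3; 4; 3] none [:: [:: 3]; [:: 4]] nones.
- nested_check c e y f g W V1 V2 neq no [:: 3; 4; 3] none [:: [:: 3]] [:: [:: 4]].
- nested_check c e y f g W V1 V2 neq [:: (4, 2)] [:: 3; 4; 3] none nones [:: [:: 3]].
- nested_check c e y f g W V1 V2 neq no [:: 3; 4; 3] none [:: [:: 4]] [:: [:: 3]].
nested_check c e y f g W V1 V2 neq no [:: 3; 4; 3] none nones [:: [:: 3]; [:: 4]].
Qed.

Lemma nested_words_simple c e y f g W V1 V2 k :
    c != e -> c != y -> e != y -> f != g -> f != c -> g != c -> e != f ->
    k <= 4 -> subseq [:: y; c; e; c] W ->
    subseq (take k [:: c; f; g; f]) W -> subseq (drop k [:: c; f; g; f]) (y :: V1) ->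
    [\/ f = y, f \in V1 | f \in V2] ->
  has_Gamma (W ++ y :: V1 ++ c :: V2).
Proof.
move=> ce cy ey fg fc gc ef + ycec.
pose no := @nil (nat * nat); pose none := @nil nat; pose nones := @nil (seq nat).
pose neq := [:: (0, 1); (0, 2); (1, 2); (3, 4); (3, 0); (4, 0); (1, 3)].
case: k => [|[|[|[|[|k]]]]] // _ h1 h2 Hf; apply: obs_nil.
- have {}h2 := subseq_cons_neq cy h2.
  nested_check c e y f g W V1 V2 neq no none [:: 0; 3; 4; 3] nones nones.
- case/subseq_consE: h2 => [[fy h2]|h2].
    nested_check c e y f g W V1 V2 neq [:: (3, 2)] [:: 0] [:: 4; 3] nones nones.
  nested_check c e y f g W V1 V2 neq no [:: 0] [:: 3; 4; 3] nones nones.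
- case/subseq_consE: h2 => [[gy h2]|h2].
    nested_check c e y f g W V1 V2 neq [:: (4, 2)] [:: 0; 3] [:: 3] nones nones.
  nested_check c e y f g W V1 V2 neq no [:: 0; 3] [:: 4; 3] nones nones.
- case/subseq_consE: h2 => [[fy h2]|h2].
    nested_check c e y f g W V1 V2 neq [:: (3, 2)] [:: 0; 3; 4] none nones nones.
  nested_check c e y f g W V1 V2 neq no [:: 0; 3; 4] [:: 3] nones nones.
case: Hf => Hf.
- nested_check c e y f g W V1 V2 neq [:: (3, 2)] [:: 0; 3; 4; 3] none nones nones.
- nested_check c e y f g W V1 V2 neq no [:: 0; 3; 4; 3] none [:: [:: 3]] nones.
nested_check c e y f g W V1 V2 neq no [:: 0; 3; 4; 3] none nones [:: [:: 3]].
Qed.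

End Words.

(** * One step of the induction, for a stack whose top is returning *)

Section Step.
Variable T : eqType.
Variables S R : seq T.
Let X := S ++ R.
Hypothesis clS : clustered S.
Hypothesis qtop : S <> [::] -> exists2 q, top S q & returning X q.
Hypothesis IH : forall S' R' : seq T, size S' + size R' < size S + size R ->
  clustered S' -> sortable S' R' \/ obs S' R'.

Lemma order_pair (x y : T) s : x != y -> x \in s -> y \in s ->
  subseq [:: x; y] s \/ subseq [:: y; x] s.
Proof.
move=> xy; rewrite -!sub1seq => hx hy.
have yx : y \notin [:: x] by rewrite inE eq_sym.
case: (subseq_insert yx hx hy) => [[k k1 h]|]; [right|by left].
by case: k k1 h.
Qed.

Lemma clustered_subseqF (x y : T) s : clustered s -> x != y ->
  subseq [:: x; y; x] s -> False.
Proof. by move=> /clusteredP h /eqP xy; apply/negP/h. Qed.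

Lemma choose U V z : R = U ++ z :: V -> z \notin V -> returning X z ->
    (z \in S -> top S z) -> clustered (kept S U V z) ->
    (forall a b t ts, dead_chain S U V z a b t ts ->
       ~~ subseq [:: z; a; b; t] (S ++ U) ->
       [/\ subseq [:: a; b] S, t \in U & z \notin S] \/ subseq [:: b; t] U ->
       obs S R) ->
  sortable S R \/ obs S R.
Proof.
move=> eR zV zr topz clK dead; have zr' := zr; rewrite /X eR in zr'.
have [||srt|ob] := IH (S' := kept S U V z) (R' := V) => //.
- rewrite eR size_cat /= addnA addnS ltnS leq_add2r -size_cat.
  exact: size_subseq (filter_subseq _ _).
- by left; rewrite eR; apply: sortable_choice srt.
right; rewrite eR; case: (choice_obs zV zr' clK topz ob) => [//|].
by case=> a [b [t [ts [d1 d2 d3]]]]; rewrite -eR; exact: dead d1 d2 d3.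
Qed.

Lemma chain3_obs a b t : uniq [:: a; b; t] -> subseq [:: a; b; t] S ->
  subseq [:: a; t] R -> obs S R.
Proof. by move=> u3 sS sR; apply: Or32; exists a, b, t, [::]. Qed.

Lemma sX s : subseq s R -> subseq s X.
Proof. exact: sub_catr. Qed.

Lemma order_top s q : top S q -> s \in S -> s != q -> subseq [:: s; q] S.
Proof. by move=> tq sS sq; apply: top_eq => //; rewrite eq_sym. Qed.

Lemma returning_in_stack s U V : R = U ++ V -> s \in S -> s \in U ->
  returning X s.
Proof.
move=> eR sS sU; have [|q tq qr] := qtop; first by move=> S0; rewrite S0 in sS.
have [<- //|sq] := eqVneq q s; apply/returningP; exists q; first by rewrite eq_sym.
rewrite /X eR -[[:: s; q; s]]/([:: s; q] ++ [:: s]) cat_subseq ?(top_eq tq) //.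
by rewrite sub1seq mem_cat sU.
Qed.

Lemma last_split (a b t : T) A Q : b \notin Q -> a != b -> t != b ->
    subseq [:: a; b; t] (A ++ b :: Q) ->
    (subseq [:: b; t; b] (A ++ b :: Q) -> False) ->
  a \in A /\ t \in Q.
Proof.
move=> bQ ab tb sub btb; split.
  case/subseq_catP: sub => k _ /andP[h1 h2].
  case: k h1 h2 => [|k] h1 h2; last by apply: (mem_subseq h1); rewrite mem_head.
  have {}h2 := subseq_cons_neq ab h2.
  by case/negP: bQ; apply: (mem_subseq h2); rewrite !inE eqxx orbT.
have bt : subseq [:: b; t] (A ++ b :: Q) by sub_of sub.
case/subseq_catP: bt => k _ /andP[h1 h2].
case: k h1 h2 => [|[|k]] h1 h2.
- by move: h2; rewrite /= eqxx sub1seq.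
- by move: h2; rewrite [drop _ _]/= sub1seq inE (negPf tb).
case: btb; rewrite -[[:: b; t; b]]/([:: b; t] ++ [:: b]) cat_subseq //.
by rewrite sub1seq mem_head.
Qed.

(** An alternation [f g f] would remain on the new stack. If [g] is simple and on the stack, the
    returning top replaces it, or, when the top is [z], a chain without links arises. If [g] is
    simple and in [U], the returning [h] that kept it either replaces [g] or leads to [z f g f]. *)
Lemma unclustered_reason U V z : R = U ++ z :: V -> z \notin V ->
    (z \in S -> top S z) -> ~~ clustered (kept S U V z) ->
  obs S R \/ exists f g, [/\ returning X f, f != g, f != z, g != z &
    returning X g /\ subseq [:: f; g; f] (S ++ U) \/
    subseq [:: z; f; g; f] (S ++ U)].
Proof.
move=> eR zV topz /clusteredPn[f [g [/eqP fg fgfK]]].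
have [fK gK] : f \in kept S U V z /\ g \in kept S U V z.
  by split; apply: (mem_subseq fgfK); rewrite !inE eqxx ?orbT.
have [fz gz] := (kept_keep fK, kept_keep gK).
have fgfW := subseq_trans fgfK (filter_subseq _ _).
have inX s : subseq s (S ++ U) -> subseq s X.
  by move=> h; rewrite /X eR catA; exact: subseq_trans h (prefix_subseq _ _).
have fr : returning X f by apply/returningP; exists g => //; exact: inX.
have reason g' : g' != z -> f != g' -> returning X g' -> subseq [:: f; g'; f] (S ++ U) ->
    obs S R \/ exists f g, [/\ returning X f, f != g, f != z, g != z &
      returning X g /\ subseq [:: f; g; f] (S ++ U) \/
      subseq [:: z; f; g; f] (S ++ U)].
  by move=> h1 h2 h3 h4; right; exists f, g'; split=> //; left.
have [gr|gr] := boolP (returning X g); first exact: (reason g).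
have gU_S : g \in U -> g \notin S.
  by move=> gU; apply: contra gr => gS; exact: returning_in_stack eR gS gU.
have [gS|gS] := boolP (g \in S).
  have [fgS fU] : subseq [:: f; g] S /\ f \in U.
    have gU : g \notin U by apply: contraL gS; exact: gU_S.
    case/subseq_catP: fgfW => k _ /andP[h1 h2].
    case: k h1 h2 => [|[|[|k]]] h1 h2.
    - by case/negP: gU; apply: (mem_subseq h2); rewrite !inE eqxx orbT.
    - by case/negP: gU; apply: (mem_subseq h2); rewrite mem_head.
    - by rewrite -sub1seq.
    case: (clustered_subseqF clS fg); apply: subseq_trans h1.
    by rewrite /= !eqxx ?sub0seq.
  have [|q tq qr] := qtop; first by move=> S0; rewrite S0 in gS.
  have qg : q != g by apply: contraNneq gr => <-.
  have fS : f \in S by apply: (mem_subseq fgS); rewrite mem_head.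
  have fq : f != q.
    by apply/eqP => fq; have := @topP _ S q g tq qg; rewrite -fq fgS.
  have [qz|qz] := eqVneq q z; last first.
    apply: (reason q) => //.
    rewrite -[[:: f; q; f]]/([:: f; q] ++ [:: f]) cat_subseq ?sub1seq //.
    exact: order_top.
  left; apply: (@chain3_obs f g q); first by distinct.
    by apply: (top_after (s := [:: f; g])); rewrite // !inE negb_or qg andbT eq_sym.
  by rewrite eR qz sub_head // sub1seq mem_head.
have gW : g \in S ++ U by apply: (mem_subseq fgfW); rewrite !inE eqxx orbT.
have gV : g \notin V.
  apply/negP => gV; apply: (returning_simple gr gz).
  by rewrite /X eR catA sub_head // sub_cons // sub1seq.
have nd : ~~ dropped S U V z g by move: gK; rewrite mem_kept => /andP[/andP[]].
have [h [hr hz zhg]] : exists h, [/\ returning X h, h != z & subseq [:: z; h; g] (S ++ U)].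
  by have := not_dropped nd; rewrite -eR; exact.
have nrW : ~~ returning (S ++ U) g.
  apply: contra gr => /returningP[d d1 d2]; apply/returningP; exists d => //.
  exact: inX.
have [A [B [eW _ left_g right_g]]] := simple_split nrW gW.
have gf : g != f by rewrite eq_sym.
have zhA : subseq [:: z; h] A.
  apply: (left_g [:: z; h]) => //; rewrite !inE negb_or gz /=.
  by apply: contraNneq gr => ->.
have fA : subseq [:: f] A.
  by apply: (left_g [:: f]); [rewrite inE | sub_of fgfW].
have fB : subseq [:: f] B.
  by apply: (right_g [:: f]); [rewrite inE | sub_of fgfW].
have zf_done : subseq [:: z; f] A -> subseq [:: z; f; g; f] (S ++ U).
  move=> zf; rewrite eW -[[:: z; f; g; f]]/([:: z; f] ++ [:: g; f]).
  by rewrite cat_subseq // sub_cons.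
have [hf|hf] := eqVneq h f.
  by right; exists f, g; split=> //; right; apply: zf_done; rewrite -hf.
have znf : z \notin [:: f] by rewrite inE eq_sym.
case: (subseq_insert znf fA zhA) => [[k k1 zf]|fzh].
  by right; exists f, g; split=> //; right; apply: zf_done; case: k k1 zf.
apply: (reason h) => //; first by rewrite eq_sym.
rewrite eW -[[:: f; h; f]]/([:: f; h] ++ [:: f]) cat_subseq //.
  by sub_of fzh.
exact: subseq_trans fB (subseq_cons _ _).
Qed.

(** * States described by the returning color [y] whose last sock comes first *)

Section Earliest.
Variables (U V : seq T) (y : T).
Hypotheses (eR : R = U ++ y :: V) (yV : y \notin V) (yr : returning X y).
Hypothesis others : forall x, returning X x -> x != y -> x \in V.

Lemma returning_R x : returning X x -> x != y -> forall s, subseq s U ->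
  subseq (s ++ [:: x]) R.
Proof.
move=> xr xy s sU; rewrite eR cat_subseq //; apply: sub_drop.
by rewrite sub1seq others.
Qed.

(** Every returning color other than [y] has a sock in [V]. Hence a dead separator is simple, and
    the top of the stack or the color [h] needed to repair the chain is live. *)
Lemma case_sorted : (y \in S -> top S y) -> clustered (kept S U V y) ->
  sortable S R \/ obs S R.
Proof.
move=> topy clK; apply: (choose eR yV yr topy clK) => a b t ts dc nz pos.
have yr' := yr; rewrite /X eR in yr'.
have [u3 abtK bV bts sV] := dc.
case: pos => [[abS tU yS]|btU].
  have [|q tq qr] := qtop; first by move=> S0; rewrite S0 in abS.
  rewrite eR; apply: (insert_top (q := q) dc) => //; apply: others => //.
  by apply: contraNneq yS => <-; case/andP: tq.
have bK : b \in kept S U V y by apply: (mem_subseq abtK); rewrite !inE eqxx orbT.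
have by_ := kept_keep bK.
have br : ~~ returning X b by apply: contra bV => br; exact: others.
have br' := br; rewrite /X eR in br'.
have qtop' : S <> [::] -> exists2 q, top S q & returning (S ++ U ++ y :: V) q.
  by rewrite -eR.
have [h [W1 [W2 [hr hz eW zh [aW tW]]]]] := simple_separator dc btU br' qtop'.
have hV : h \in V by apply: others => //; rewrite /X eR.
apply: Or31; rewrite eR; apply: (dead_separator (ts := ts) yV clK eW u3 abtK aW tW zh) => //.
apply: returning_kept => //; rewrite eW mem_cat; apply/orP; left.
by apply: (mem_subseq zh); rewrite !inE eqxx orbT.
Qed.

(* The top of the stack has to be output before [y]. *)
Lemma case_buried : y \in S -> ~~ top S y -> sortable S R \/ obs S R.
Proof.
move=> yS ntop.
have [|q tq qr] := qtop; first by move=> S0; rewrite S0 in yS.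
have qy : q != y by apply: contraNneq ntop => <-.
have yqS := top_eq tq qy yS.
have [V1 [V2 [eV qV2]]] := last_occurrence (others qr qy).
pose U' := U ++ y :: V1.
have eR' : R = U' ++ q :: V2 by rewrite eR eV /U' -catA.
have yV1 : y \notin V1 by apply: contra yV; rewrite eV mem_cat => ->.
have yV2 : y \notin V2 by apply: contra yV; rewrite eV mem_cat inE => ->; rewrite !orbT.
have qV : q \in V by exact: others.
have sU'q s : subseq s U' -> subseq (rcons s q) R.
  by move=> h; rewrite eR' -cats1 cat_subseq // sub1seq mem_head.
(* Below the top [q], either order of [s] and [y] gives a chain without links. *)
have stack s : s \in S -> s != y -> s != q -> subseq [:: s; q] R -> obs S R.
  move=> sS sy sq sqR; have [ys|sy'] := order_pair sy sS yS; last first.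
    apply: (@chain3_obs y s q); first by distinct.
    + by apply: (top_after (s := [:: y; s])); rewrite // !inE negb_or qy eq_sym.
    by rewrite eR; apply: sub_catr; apply: sub_cons; rewrite sub1seq.
  apply: (@chain3_obs s y q) => //; first by distinct.
  by apply: (top_after (s := [:: s; y])); rewrite // !inE negb_or qy andbT eq_sym.
have short_yq c d : uniq [:: y; q; c] -> d \notin [:: y; q; c] ->
    [\/ subseq [:: y; c; y; q] R, subseq [:: c; y; q; c] R,
        subseq [:: c; y; c; q] R | subseq [:: y; c; d; c; q] R] -> obs S R.
  move=> u3 dn pat; apply: Or33; exists y, q, c; split=> //.
  case: pat => h; [exact: Or41|exact: Or42|exact: Or43|].
  by apply: Or44; exists d.
have both u : u \in U -> u \in V -> u != y -> u != q -> obs S R.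
  move=> uU uV uy uq; apply: Or33; exists y, q, u; split=> //; first by distinct.
  have [quV|uqV] := order_pair uq uV qV; [apply: Or43|apply: Or42];
    by rewrite eR sub_head // sub_cons.
have clK : clustered (kept S U' V2 q) \/ obs S R.
  have [clK|ncl] := boolP (clustered (kept S U' V2 q)); [by left | right].
  case/clusteredPn: ncl => f [g [/eqP fg fgfK]].
  have [fK gK] : f \in kept S U' V2 q /\ g \in kept S U' V2 q.
    by split; apply: (mem_subseq fgfK); rewrite !inE eqxx ?orbT.
  have [fq gq] := (kept_keep fK, kept_keep gK).
  have fgfW := subseq_trans fgfK (filter_subseq _ _).
  have fr : returning X f.
    apply/returningP; exists g => //; rewrite /X eR' catA.
    exact: subseq_trans fgfW (prefix_subseq _ _).
  have [fy|fy] := eqVneq f y.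
    have gy : g != y by rewrite -fy eq_sym.
    have [gS|gS] := boolP (g \in S).
      have gU' : g \in U' \/ subseq [:: y; g] S.
        move: fgfW; rewrite fy => /subseq_catP[k _ /andP[h1 h2]].
        case: k h1 h2 => [|[|k]] h1 h2.
        - by left; apply: (mem_subseq h2); rewrite !inE eqxx orbT.
        - by left; apply: (mem_subseq h2); rewrite !inE eqxx.
        by right; apply: subseq_trans h1; rewrite /= !eqxx ?sub0seq.
      case: gU' => [gU'|ygS].
        by apply: (stack g) => //; apply: (sU'q [:: g]); rewrite sub1seq.
      apply: (@chain3_obs y g q); first by distinct.
        by apply: (top_after (s := [:: y; g])); rewrite // !inE negb_or qy eq_sym.
      by rewrite eR; apply: sub_catr; apply: sub_cons; rewrite sub1seq.
    have gyU' : subseq [:: g; y] U'.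
      move: fgfW; rewrite fy => /subseq_catP[k _ /andP[h1 h2]].
      case: k h1 h2 => [|[|k]] h1 h2.
      - by apply: subseq_trans h2; exact: sub_drop.
      - by [].
      by case/negP: gS; apply: (mem_subseq h1); rewrite /= !inE eqxx orbT.
    have gU : g \in U.
      case/subseq_catP: gyU' => k _ /andP[h1 h2].
      case: k h1 h2 => [|k] h1 h2; last by apply: (mem_subseq h1); rewrite mem_head.
      move: h2; rewrite /= (negPf gy) => h2.
      by case/negP: yV1; apply: (mem_subseq h2); rewrite !inE eqxx orbT.
    have [gr|gr] := boolP (returning X g).
      by apply: (both g) => //; exact: others.
    have gV : g \notin V.
      apply/negP => gV; apply: (returning_simple gr gy); apply: sX.
      by rewrite eR sub_head // sub_cons // sub1seq.
    have gV2 : g \notin V2.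
      by apply: contra gV; rewrite eV mem_cat inE => ->; rewrite !orbT.
    have nd : ~~ dropped S U' V2 q g by move: gK; rewrite mem_kept => /andP[/andP[]].
    have [h [hr hq qhg]] : exists h, [/\ returning X h, h != q & subseq [:: q; h; g] (S ++ U')].
      by have := not_dropped nd; rewrite -eR'; exact.
    have hgU' : subseq [:: h; g] U'.
      case/subseq_catP: qhg => k _ /andP[h1 h2].
      case: k h1 h2 => [|[|k]] h1 h2.
      - by apply: subseq_trans h2; exact: sub_drop.
      - by [].
      have qh : q != h by rewrite eq_sym.
      by case/negP: (topP tq qh); apply: subseq_trans h1; rewrite /= !eqxx ?sub0seq.
    have gyV1 : g \notin y :: V1.
      by rewrite inE negb_or gy; apply: contra gV; rewrite eV mem_cat => ->.
    have hgU : subseq [:: h; g] U.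
      case/subseq_catP: hgU' => k _ /andP[h1 h2].
      case: k h1 h2 => [|[|k]] h1 h2.
      - by case/negP: gyV1; apply: (mem_subseq h2); rewrite !inE eqxx orbT.
      - by case/negP: gyV1; apply: (mem_subseq h2); rewrite !inE eqxx.
      by apply: subseq_trans h1; rewrite /= !eqxx ?sub0seq.
    have hU : h \in U by apply: (mem_subseq hgU); rewrite mem_head.
    have [hy|hy] := eqVneq h y.
      apply: Or33; exists y, q, g; split=> //; first by distinct.
      apply: Or41; rewrite eR -[[:: y; g; y; q]]/([:: y; g] ++ [:: y; q]).
      by rewrite cat_subseq //; [rewrite -hy | apply: sub_cons; rewrite sub1seq].
    by apply: (both h) => //; exact: others.
  have [fS|fS] := boolP (f \in S).
    apply: (stack f) => //; apply: (sU'q [:: f]); rewrite sub1seq.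
    case/subseq_catP: fgfW => k _ /andP[h1 h2].
    case: k h1 h2 => [|[|[|k]]] h1 h2.
    - by apply: (mem_subseq h2); rewrite mem_head.
    - by apply: (mem_subseq h2); rewrite !inE eqxx orbT.
    - by apply: (mem_subseq h2); rewrite mem_head.
    case: (clustered_subseqF clS fg); apply: subseq_trans h1.
    by rewrite /= !eqxx ?sub0seq.
  have fgfU' : subseq [:: f; g; f] U'.
    case/subseq_catP: fgfW => k _ /andP[h1 h2].
    case: k h1 h2 => [|k] h1 h2 //.
    by case/negP: fS; apply: (mem_subseq h1); rewrite mem_head.
  have [fU|fU] := boolP (f \in U); first by apply: (both f) => //; exact: others.
  have fgfV1 : subseq [:: f; g; f] V1.
    case/subseq_catP: fgfU' => k _ /andP[h1 h2].
    case: k h1 h2 => [|k] h1 h2; first exact: subseq_cons_neq h2.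
    by case/negP: fU; apply: (mem_subseq h1); rewrite mem_head.
  have gy : g != y.
    apply: contraNneq yV1 => <-.
    by apply: (mem_subseq fgfV1); rewrite !inE eqxx orbT.
  apply: Or33; exists y, q, f; split=> //; first by distinct.
  apply: Or44; exists g; first by rewrite !inE !negb_or gy gq eq_sym.
  rewrite eR eV; apply: sub_catr; apply: sub_cons.
  by rewrite -[[:: f; g; f; q]]/([:: f; g; f] ++ [:: q]) cat_subseq // sub1seq mem_head.
case: clK => [clK|ob]; last by right.
apply: (choose eR' qV2 qr (fun _ => tq) clK) => a b t ts dc nz pos.
have [u3 abtK bV2 bts sV2] := dc.
have [aK bK tK] : [/\ a \in kept S U' V2 q, b \in kept S U' V2 q & t \in kept S U' V2 q].
  by split; apply: (mem_subseq abtK); rewrite !inE eqxx ?orbT.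
move: u3; rewrite /= !inE !negb_or !andbT => /andP[/andP[ab at_] bt].
have qS : q \in S by case/andP: tq.
have btU' : subseq [:: b; t] U' by case: pos => // -[_ _]; rewrite qS.
have aS : a \in S.
  have := subseq_trans abtK (filter_subseq _ _).
  move=> /subseq_catP[k _ /andP[h1 h2]].
  case: k h1 h2 => [|k] h1 h2; last by apply: (mem_subseq h1); rewrite mem_head.
  by case/negP: nz; rewrite sub_head.
have aV2 : a \in V2 by apply: (mem_subseq sV2); exact: chain_end_mem.
have aq := kept_keep aK.
have ay : a != y by apply: contraNneq yV2 => <-.
have [ya|ay'] := order_pair ay aS yS; last first.
  apply: (@chain3_obs y a q); first by distinct.
    by apply: (top_after (s := [:: y; a])); rewrite // !inE negb_or qy eq_sym.
  by rewrite eR; apply: sub_catr; apply: sub_cons; rewrite sub1seq.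
have ty : t != y.
  apply/eqP => ty; have yb : y != b by rewrite -ty eq_sym.
  apply: (kept_alternate clK (a := y) (b := b)) => //; first by rewrite -ty.
  by rewrite sub_head // -ty.
(* [y] replaces the dead separator, and [q] replaces [t], with [t q] as a new first link. *)
apply: Or32; exists a, y, q, (t :: ts); split.
- by distinct.
- by apply: (top_after (s := [:: a; y])); rewrite // !inE negb_or qy andbT eq_sym.
- rewrite inE negb_or eq_sym ty /=.
  by apply: contra yV2 => /(chain_links_mem a t)/(mem_subseq sV2).
rewrite eR' /= sub_head //; last exact: sub_cons.
by apply: (mem_subseq btU'); rewrite !inE eqxx orbT.
Qed.

Lemma returning_after x s : returning X x -> subseq s U -> subseq (rcons s x) R.
Proof.
move=> xr sU; have [->|xy] := eqVneq x y; last by rewrite -cats1 returning_R.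
by rewrite eR -cats1 cat_subseq // sub1seq mem_head.
Qed.

Lemma located_later x V1 z V2 : V = V1 ++ z :: V2 -> returning X x -> x != z ->
  [\/ x = y, x \in V1 | x \in V2].
Proof.
move=> eV xr xz; have [->|xy] := eqVneq x y; first exact: Or31.
have := others xr xy; rewrite eV mem_cat inE (negPf xz) /=.
by case/orP; [apply: Or32|apply: Or33].
Qed.

(** * Two returning colors that alternate before the last [y] *)

Section Crossing.
Variables (z w : T) (V1 V2 : seq T) (b0 : bool).
Hypotheses (zw : z != w) (zy : z != y) (wy : w != y).
Hypotheses (zr : returning X z) (wr : returning X w).
Hypotheses (eV : V = V1 ++ z :: V2) (zV2 : z \notin V2) (wV2 : w \in V2).
Hypothesis cross : subseq (if b0 then [:: z; w; z] else [:: w; z; w]) (S ++ U).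

Let U' := U ++ y :: V1.

Lemma crossing_R : R = U' ++ z :: V2.
Proof. by rewrite eR eV /U' -catA. Qed.

(** However the alternation of [z] and [w] is split between [S] and [U], a [z] below the top [q]
    yields a chain without links starting at [q], or a short obstruction with [z q] on the stack. *)
Lemma crossing_top : z \in S -> top S z \/ obs S R.
Proof.
move=> zS; have [tz|ntop] := boolP (top S z); first by left.
right; have [|q tq qr] := qtop; first by move=> S0; rewrite S0 in zS.
have zq : z != q by apply: contraNneq ntop => ->.
have zV : z \in V by rewrite eV mem_cat mem_head orbT.
have wV : w \in V by rewrite eV mem_cat inE wV2 !orbT.
have below s : s \in S -> subseq [:: z; s] S -> z != s -> z \in U -> s != q -> obs S R.
  move=> sS zsS zs zU sq; apply: (@chain3_obs z s q); first by distinct.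
    by apply: (top_after (s := [:: z; s])); rewrite // !inE negb_or !(eq_sym q) zq.
  by apply: (returning_after (s := [:: z])); rewrite ?sub1seq.
have above s : subseq [:: s; z] S -> s != z -> s \in U -> obs S R.
  move=> szS sz sU; have sq : s != q.
    by apply/eqP => sq; have := @topP _ S q z tq; rewrite eq_sym zq -sq szS => /(_ isT).
  apply: (@chain3_obs s z q); first by distinct.
    by apply: (top_after (s := [:: s; z])); rewrite // !inE negb_or !(eq_sym q) zq andbT.
  by apply: (returning_after (s := [:: s])); rewrite ?sub1seq.
have w_top : w = q -> z \in U -> obs S R.
  move=> wq zU; apply: Or33; exists z, q, y; split; first by rewrite -wq; distinct.
    exact: order_top.
  apply: Or41; rewrite eR eV -wq sub_head // sub_cons // sub_catr // sub_cons //.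
  by rewrite sub1seq.
have w_out : w \notin S -> subseq [:: w; z] U -> obs S R.
  move=> wS wzU; have wq : w != q by apply: contraNneq wS => ->; case/andP: tq.
  apply: Or33; exists z, q, w; split; first by distinct.
    exact: order_top.
  have [qy|qy] := eqVneq q y.
    apply: Or42; rewrite eR -[[:: w; z; q; w]]/([:: w; z] ++ [:: q; w]) qy.
    by rewrite cat_subseq // sub_cons // sub1seq.
  have qV : q \in V by exact: others.
  have [wqV|qwV] := order_pair wq wV qV; [apply: Or43|apply: Or42]; rewrite eR.
    by rewrite -[[:: w; z; w; q]]/([:: w; z] ++ [:: w; q]) cat_subseq // sub_drop.
  by rewrite -[[:: w; z; q; w]]/([:: w; z] ++ [:: q; w]) cat_subseq // sub_drop.
have w_in : w \in S -> z \in U -> w \in U -> obs S R.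
  move=> wS zU wU; have [wq|wq] := eqVneq w q; first exact: w_top.
  have [zwS|wzS] := order_pair zw zS wS; first exact: (below w).
  by apply: (above w) => //; rewrite eq_sym.
have wzU : subseq [:: w; z] U -> obs S R.
  move=> h; have [wS|wS] := boolP (w \in S); last exact: w_out.
  by apply: w_in => //; apply: (mem_subseq h); rewrite !inE eqxx ?orbT.
move: cross => /subseq_catP[k _ /andP[h1 h2]].
have wz : w != z by rewrite eq_sym.
case: b0 h1 h2 => h1 h2; case: k h1 h2 => [|[|[|k]]] h1 h2.
- by apply: wzU; apply: subseq_trans h2; exact: sub_drop.
- exact: wzU.
- have zU : z \in U by rewrite -sub1seq.
  have wS : w \in S by apply: (mem_subseq h1); rewrite !inE eqxx orbT.
  by have [wq|wq] := eqVneq w q; [exact: w_top | exact: (below w)].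
- by case: (clustered_subseqF clS zw); apply: subseq_trans h1; rewrite /= !eqxx ?sub0seq.
- apply: wzU; apply: subseq_trans h2.
  by rewrite -[[:: w; z; w]]/([:: w; z] ++ [:: w]) prefix_subseq.
- by apply: w_in; [apply: (mem_subseq h1)|apply: (mem_subseq h2)|apply: (mem_subseq h2)];
    rewrite !inE eqxx ?orbT.
- by apply: (above w) => //; rewrite -sub1seq.
by case: (clustered_subseqF clS wz); apply: subseq_trans h1; rewrite /= !eqxx ?sub0seq.
Qed.

Lemma crossing_clustered : (z \in S -> top S z) ->
  clustered (kept S U' V2 z) \/ obs S R.
Proof.
move=> topz; have [|ncl] := boolP (clustered (kept S U' V2 z)); [by left | right].
have [//|[f [g [fr fg fz gz]]]] := unclustered_reason crossing_R zV2 topz ncl.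
have loc x : returning X x -> x != z -> exists h, located x h (y :: V1) V2.
  move=> xr xz; case: (located_later eV xr xz) => hx; [exists true|exists true|exists false];
  by rewrite /located ?inE ?hx ?eqxx ?orbT.
have [hf Hf] := loc f fr fz.
have yz : y != z by rewrite eq_sym.
have yw : y != w by rewrite eq_sym.
have eX : S ++ R = (S ++ U) ++ (y :: V1) ++ z :: V2 by rewrite eR eV -!catA.
rewrite /U' catA; case=> [[gr]|] /subseq_catP[k ks /andP[h1 h2]]; apply: Or31; rewrite eX.
  have [hg Hg] := loc g gr gz.
  by apply: (@crossing_words _ z w y f g _ _ _ k b0 hf hg) => //; exact: mem_head.
by apply: (@crossing_words_simple _ z w y f g _ _ _ k b0 hf) => //; exact: mem_head.
Qed.

(** A dead returning separator has its last sock in [y :: V1], thus after [z w]. As [w] outlives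
    [z], it is the live color that [dead_separator] asks for. A simple separator gives a returning
    [h]: if [h] is live, [dead_separator] applies to it directly, and otherwise [h] itself becomes a
    dead returning separator of the same chain. *)
Lemma case_crossing : sortable S R \/ obs S R.
Proof.
have [topz|] : (z \in S -> top S z) \/ obs S R; last by right.
  have [zS|zS] := boolP (z \in S); last by left.
  by case: (crossing_top zS); [left|right].
have [clK|] := crossing_clustered topz; last by right.
have eR' := crossing_R.
have zr' := zr; rewrite /X eR' in zr'.
apply: (choose eR' zV2 zr topz clK) => a b t ts dc nz pos.
have zwW : subseq [:: z; w] (S ++ U).
  by move: cross; case: b0 => h; sub_of h.
have zw_kept x : x != z -> returning X x -> x \in S ++ U' -> x \in kept S U' V2 z.
  by move=> xz xr xW; apply: returning_kept => //; rewrite -eR'.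
have wW : w \in S ++ U by apply: (mem_subseq zwW); rewrite !inE eqxx orbT.
have wK : w \in kept S U' V2 z.
  by apply: zw_kept; rewrite // ?(eq_sym w) // /U' catA mem_cat wW.
have dead_ret b' : dead_chain S U' V2 z a b' t ts -> returning X b' -> obs S R.
  case=> u3 abtK bV2 bts sV br.
  have [aK bK tK] : [/\ a \in kept S U' V2 z, b' \in kept S U' V2 z & t \in kept S U' V2 z].
    by split; apply: (mem_subseq abtK); rewrite !inE eqxx ?orbT.
  have u3' := u3; move: u3'; rewrite /= !inE !negb_or !andbT => /andP[/andP[ab at_] bt].
  have bY : b' \in y :: V1.
    case: (located_later eV br (kept_keep bK)) => hb; rewrite inE ?hb ?eqxx ?orbT //.
    by rewrite hb in bV2.
  have [P [Q [eY bQ]]] := last_occurrence bY.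
  have eW : S ++ U' = (S ++ U ++ P) ++ b' :: Q by rewrite /U' eY -!catA.
  have [aA tQ] : a \in S ++ U ++ P /\ t \in Q.
    apply: (last_split (b := b')) => //; first by rewrite eq_sym.
      by rewrite -eW; exact: subseq_trans abtK (filter_subseq _ _).
    by rewrite -eW; apply: (kept_alternate clK).
  apply: Or31; rewrite eR'.
  apply: (dead_separator (a := a) (t := t) (ts := ts) (h := w) zV2 clK eW) => //.
  by rewrite catA; exact: subseq_trans zwW (prefix_subseq _ _).
have [u3 abtK bV2 bts sV] := dc.
case: pos => [[abS tU zS]|btU].
  have [|q tq qr] := qtop; first by move=> S0; rewrite S0 in abS.
  have qS : q \in S by case/andP: tq.
  have qz : q != z by apply: contraNneq zS => <-.
  have [qV2|qV2] := boolP (q \in V2).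
    by rewrite eR'; exact: (insert_top (q := q) dc).
  have qY : q \in y :: V1.
    case: (located_later eV qr qz) => hq; rewrite inE ?hq ?eqxx ?orbT //.
    by rewrite hq in qV2.
  have wU : w \in U.
    move: cross => /subseq_catP[k _ /andP[h1 h2]].
    case: b0 h1 h2 => h1 h2; case: k h1 h2 => [|[|k]] h1 h2.
    - by apply: (mem_subseq h2); rewrite !inE eqxx orbT.
    - by apply: (mem_subseq h2); rewrite mem_head.
    - by case/negP: zS; apply: (mem_subseq h1); rewrite mem_head.
    - by apply: (mem_subseq h2); rewrite mem_head.
    - by apply: (mem_subseq h2); rewrite !inE eqxx orbT.
    by case/negP: zS; apply: (mem_subseq h1); rewrite !inE eqxx orbT.
  have qw : q != w by apply: contraNneq qV2 => ->.
  case: (kept_alternate clK qw _ wK).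
    by apply: zw_kept; rewrite // mem_cat qS.
  by rewrite /U' sub_head // sub_head // sub1seq.
have [br|br] := boolP (returning X b); first exact: (dead_ret b).
have br' := br; rewrite /X eR' in br'.
have qtop' : S <> [::] -> exists2 q, top S q & returning (S ++ U' ++ z :: V2) q.
  by rewrite -eR'.
have [h [W1 [W2 [hr hz eW zh [aW tW]]]]] := simple_separator dc btU br' qtop'.
have hW1 : h \in W1 by apply: (mem_subseq zh); rewrite !inE eqxx orbT.
have hK : h \in kept S U' V2 z.
  by apply: returning_kept; rewrite // eW mem_cat hW1.
have [hV2|hV2] := boolP (h \in V2).
  by apply: Or31; rewrite eR'; exact: (dead_separator (ts := ts) zV2 clK eW u3 abtK aW tW zh).
have [aK bK tK] : [/\ a \in kept S U' V2 z, b \in kept S U' V2 z & t \in kept S U' V2 z].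
  by split; apply: (mem_subseq abtK); rewrite !inE eqxx ?orbT.
have u3' := u3; move: u3'; rewrite /= !inE !negb_or !andbT => /andP[/andP[ab at_] bt].
have aV2 : a \in V2 by apply: (mem_subseq sV); exact: chain_end_mem.
have ah : a != h by apply: contraNneq hV2 => <-.
have zna : z \notin [:: a] by rewrite inE eq_sym; exact: kept_keep aK.
have saW1 : subseq [:: a] W1 by rewrite sub1seq.
have btW : subseq [:: b; t] (b :: W2) by rewrite sub_cons // sub1seq.
case: (subseq_insert zna saW1 zh) => [[k k1 za]|azh].
  case/negP: nz; rewrite eW -[[:: z; a; b; t]]/([:: z; a] ++ [:: b; t]).
  by rewrite cat_subseq //; case: k k1 za.
have azhbt : subseq ([:: a; z; h] ++ [:: b; t]) (S ++ U') by rewrite eW cat_subseq.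
have ht : h != t.
  apply/eqP => ht; case: (kept_alternate clK _ tK bK); first by rewrite eq_sym.
  by rewrite -{1}ht; sub_of azhbt.
apply: (dead_ret h); last by rewrite /X eR'.
have ahtK : subseq [:: a; h; t] (kept S U' V2 z).
  rewrite subseq_filter /=; apply/andP; split; last by sub_of azhbt.
  by move: aK hK tK; rewrite !mem_kept => /andP[-> _] /andP[-> _] /andP[-> _].
split=> //; first by distinct.
by apply: contra hV2 => /(chain_links_mem a t)/(mem_subseq sV).
Qed.

End Crossing.

(** * A simple color enclosed by a returning color [c], after a sock of [y] *)

Section Nested.
Variables (c e : T) (V1 V2 : seq T).
Hypotheses (ce : c != e) (cy : c != y) (ey : e != y).
Hypotheses (cr : returning X c) (er : ~~ returning X e).
Hypotheses (eV : V = V1 ++ c :: V2) (cV2 : c \notin V2).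
Hypothesis topy : y \in S -> top S y.
Hypothesis nested : subseq [:: y; c; e; c] (S ++ U).

Let U' := U ++ y :: V1.

Lemma nested_R : R = U' ++ c :: V2.
Proof. by rewrite eR eV /U' -catA. Qed.

Lemma nested_U : subseq [:: c; e; c] U.
Proof.
case/subseq_catP: nested => k _ /andP[h1 h2].
case: k h1 h2 => [|[|k]] h1 h2.
- by apply: subseq_trans h2; exact: sub_drop.
- by [].
have yS : y \in S by apply: (mem_subseq h1); rewrite mem_head.
have yc : y != c by rewrite eq_sym.
by case/negP: (topP (topy yS) yc); apply: subseq_trans h1; rewrite /= !eqxx ?sub0seq.
Qed.

Lemma nested_e : e \notin V.
Proof.
apply/negP => hV; have ec : e != c by rewrite eq_sym.
apply: (returning_simple er ec); rewrite /X eR catA.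
rewrite -[[:: e; c; e]]/([:: e; c] ++ [:: e]) cat_subseq //; first by sub_of nested.
by rewrite sub1seq inE hV orbT.
Qed.

Lemma nested_top : c \in S -> top S c \/ obs S R.
Proof.
move=> cS; have [tc|ntop] := boolP (top S c); first by left.
right; have [|q tq qr] := qtop; first by move=> S0; rewrite S0 in cS.
have cq : c != q by apply: contraNneq ntop => ->.
have eq : e != q by apply: contraNneq er => ->.
apply: Or33; exists c, q, e; split; [by distinct | exact: order_top |].
by apply: Or41; apply: (returning_after (s := [:: c; e; c]) qr nested_U).
Qed.

Lemma nested_clustered : (c \in S -> top S c) ->
  clustered (kept S U' V2 c) \/ obs S R.
Proof.
move=> topc; have [|ncl] := boolP (clustered (kept S U' V2 c)); [by left | right].
have [//|[f [g [fr fg fc gc]]]] := unclustered_reason nested_R cV2 topc ncl.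
have Hf := located_later eV fr fc.
have ef : e != f by apply: contraNneq er => ->.
have eX : S ++ R = (S ++ U) ++ y :: V1 ++ c :: V2 by rewrite eR eV -!catA.
rewrite /U' catA; case=> [[gr]|] /subseq_catP[k ks /andP[h1 h2]]; apply: Or31; rewrite eX.
  have Hg := located_later eV gr gc.
  have eg : e != g by apply: contraNneq er => ->.
  exact: (nested_words ce cy ey fg fc gc ef eg ks nested h1 h2 Hf Hg).
exact: (nested_words_simple ce cy ey fg fc gc ef ks nested h1 h2 Hf).
Qed.

(** In this word of [I_{4,n}], [y] is the separator, [c] the first chain color, and [t c] a new link
    in front of the old chain. *)
Lemma nested_I4 a t ts : subseq [:: a; y; c; e; c] (S ++ U) -> a != c -> t \in V1 ->
  c != t -> subseq (chain a t ts) V2 -> has_Gamma X.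
Proof.
move=> sub ac tV1 ct sV.
have V2V : {subset V2 <= V} by move=> x; rewrite eV mem_cat inE => ->; rewrite !orbT.
have V1V : {subset V1 <= V} by move=> x; rewrite eV mem_cat => ->.
have eV' := nested_e.
have aV : a \in V by apply: V2V; apply: (mem_subseq sV); exact: chain_end_mem.
have tsV : {subset t :: ts <= V}.
  move=> x; rewrite inE => /orP[/eqP->|xts]; first exact: V1V.
  by apply: V2V; apply: (mem_subseq sV); exact: chain_links_mem.
have ay : a != y by apply: contraNneq yV => <-.
have ae : a != e by apply: contraNneq eV' => <-.
apply: (@Gamma_I4 _ a y e c (t :: ts)); first by distinct.
- by apply: contra yV; exact: tsV.
- by apply: contra eV'; exact: tsV.
rewrite /X eR eV catA.
rewrite -[_ ++ chain _ _ _]/([:: a; y; c; e; c] ++ y :: t :: c :: chain a t ts).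
by rewrite cat_subseq // sub_cons // sub_head // sub_cons.
Qed.

(** A dead returning separator forces [t] into [V1]. Moreover [a] precedes [y c e c], because [a]
    and [y] are both kept and must not alternate; so [nested_I4] applies. Simple separators are
    replaced by a returning color as in the crossing case. *)
Lemma case_nested : sortable S R \/ obs S R.
Proof.
have [topc|] : (c \in S -> top S c) \/ obs S R; last by right.
  have [cS|cS] := boolP (c \in S); last by left.
  by case: (nested_top cS); [left|right].
have [clK|] := nested_clustered topc; last by right.
have eR' := nested_R.
have cr' := cr; rewrite /X eR' in cr'.
have yV1 : y \notin V1 by apply: contra yV; rewrite eV mem_cat => ->.
have yV2 : y \notin V2 by apply: contra yV; rewrite eV mem_cat inE => ->; rewrite !orbT.
have in_kept x : x != c -> returning X x -> x \in S ++ U' -> x \in kept S U' V2 c.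
  by move=> xc xr xW; apply: returning_kept => //; rewrite -eR'.
have yc : y != c by rewrite eq_sym.
have yK : y \in kept S U' V2 c.
  by apply: in_kept; rewrite // !mem_cat mem_head !orbT.
apply: (choose eR' cV2 cr topc clK) => a b t ts dc nz pos.
have [u3 abtK bV2 bts sV] := dc.
have [aK bK tK] : [/\ a \in kept S U' V2 c, b \in kept S U' V2 c & t \in kept S U' V2 c].
  by split; apply: (mem_subseq abtK); rewrite !inE eqxx ?orbT.
have [ac bc tc] := And3 (kept_keep aK) (kept_keep bK) (kept_keep tK).
have ct : c != t by rewrite eq_sym.
move: (u3); rewrite /= !inE !negb_or !andbT => /andP[/andP[ab at_] bt].
have aV2 : a \in V2 by apply: (mem_subseq sV); exact: chain_end_mem.
have ay : a != y by apply: contraNneq yV2 => <-.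
have no_ret x : x \in kept S U' V2 c -> x != y -> subseq [:: y; x] (S ++ U) -> False.
  move=> xK xy sub; apply: (kept_alternate clK (a := y) (b := x)) => //.
    by rewrite eq_sym.
  rewrite /U' catA -[[:: y; x; y]]/([:: y; x] ++ [:: y]) cat_subseq //.
  by rewrite sub1seq mem_head.
have aSU : a \in S ++ U.
  apply: contraT => aW; case/negP: nz.
  have := subseq_trans abtK (filter_subseq _ _).
  rewrite /U' !catA => /subseq_catP[k _ /andP[h1 h2]].
  case: k h1 h2 => [|k] h1 h2; last first.
    by case/negP: aW; apply: (mem_subseq h1); rewrite mem_head.
  rewrite -[[:: c; a; b; t]]/([:: c] ++ [:: a; b; t]) cat_subseq //.
  by sub_of nested.
have dead_ret b' : dead_chain S U' V2 c a b' t ts -> returning X b' -> obs S R.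
  case=> u3' abtK' bV2' bts' _ br'.
  have b'K : b' \in kept S U' V2 c by apply: (mem_subseq abtK'); rewrite !inE eqxx orbT.
  move: u3'; rewrite /= !inE !negb_or !andbT => /andP[/andP[ab' _] b't].
  have bY : b' \in y :: V1.
    case: (located_later eV br' (kept_keep b'K)) => hb; rewrite inE ?hb ?eqxx ?orbT //.
    by rewrite hb in bV2'.
  have [P [Q [eY bQ]]] := last_occurrence bY.
  have eW : S ++ U' = (S ++ U ++ P) ++ b' :: Q by rewrite /U' eY -!catA.
  have abtW := subseq_trans abtK' (filter_subseq _ _).
  have [_ tQ] : a \in S ++ U ++ P /\ t \in Q.
    apply: (last_split (b := b')) => //; rewrite ?(eq_sym t) -?eW //.
    by apply: (kept_alternate clK).
  have tV1 : t \in V1.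
    case: P eY {eW} => [[_ ->] //|p P [_ ->]].
    by rewrite mem_cat inE tQ !orbT.
  apply: Or31; apply: (@nested_I4 a t ts) => //.
  have yna : y \notin [:: a] by rewrite inE eq_sym.
  have saW : subseq [:: a] (S ++ U) by rewrite sub1seq.
  case: (subseq_insert yna saW nested) => [[k k1 ya]|//].
  by case: (no_ret a aK ay); case: k k1 ya => // _ h; sub_of h.
case: pos => [[abS tU cS]|btU].
  have [|q tq qr] := qtop; first by move=> S0; rewrite S0 in abS.
  have qS : q \in S by case/andP: tq.
  have qc : q != c by apply: contraNneq cS => <-.
  have [qV2|qV2] := boolP (q \in V2).
    by rewrite eR'; exact: (insert_top (q := q) dc).
  have [qy|qy] := eqVneq q y; last first.
    have qV1 : q \in V1.
      by case: (located_later eV qr qc) => hq //; [rewrite hq eqxx in qy | rewrite hq in qV2].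
    case: (kept_alternate clK qy _ yK); first by apply: in_kept; rewrite // mem_cat qS.
    by rewrite /U' sub_head // sub_catr // sub_cons // sub1seq.
  move: tq qS; rewrite qy => tq yS.
  have yab : a != y -> b != y -> subseq [:: a; b; y] S.
    move=> ay' by'; apply: (top_after (s := [:: a; b]) tq) => //.
    by rewrite !inE negb_or !(eq_sym y) ay' by'.
  have [ty|ty] := eqVneq t y.
    apply: Or32; exists a, b, t, ts; split=> //; first by rewrite ty yab // -ty.
    by rewrite eR'; apply: sub_catr; exact: sub_drop.
  have tV1 : t \in V1.
    move: tU; rewrite mem_cat inE (negPf ty) /= => /orP[tU|//].
    by case: (no_ret t tK ty); rewrite sub_head // sub1seq.
  have [by_|by_] := eqVneq b y.
    apply: Or31; apply: (@nested_I4 a t ts) => //.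
    rewrite -[[:: a; y; c; e; c]]/([:: a; y] ++ [:: c; e; c]).
    by rewrite cat_subseq ?nested_U // -by_.
  (* Two links are added: [c y], with [c] in [U], and [t c], with [t] in [V1]. *)
  apply: Or32; exists a, b, y, [:: c, t & ts]; split.
  - by distinct.
  - exact: yab.
  - by rewrite !inE !negb_or bc bt bts.
  rewrite eR eV /= sub_head //.
    by apply: (mem_subseq nested_U); rewrite mem_head.
  by rewrite sub_cons // sub_head // sub_cons.
have [br|br] := boolP (returning X b); first exact: (dead_ret b).
have br' := br; rewrite /X eR' in br'.
have qtop' : S <> [::] -> exists2 q, top S q & returning (S ++ U' ++ c :: V2) q.
  by rewrite -eR'.
have [h [W1 [W2 [hr hc eW ch [aW tW]]]]] := simple_separator dc btU br' qtop'.
have hW1 : h \in W1 by apply: (mem_subseq ch); rewrite !inE eqxx orbT.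
have hK : h \in kept S U' V2 c by apply: returning_kept; rewrite // eW mem_cat hW1.
have [hV2|hV2] := boolP (h \in V2).
  by apply: Or31; rewrite eR'; exact: (dead_separator (ts := ts) cV2 clK eW u3 abtK aW tW ch).
have ah : a != h by apply: contraNneq hV2 => <-.
have cna : c \notin [:: a] by rewrite inE eq_sym.
have saW1 : subseq [:: a] W1 by rewrite sub1seq.
have btW : subseq [:: b; t] (b :: W2) by rewrite sub_cons // sub1seq.
have ca_done : subseq [:: c; a] W1 -> False.
  move=> ca; case/negP: nz; rewrite eW -[[:: c; a; b; t]]/([:: c; a] ++ [:: b; t]).
  by rewrite cat_subseq.
case: (subseq_insert cna saW1 ch) => [[k k1 ca]|ach].
  by case: ca_done; case: k k1 ca.
have achbt : subseq ([:: a; c; h] ++ [:: b; t]) (S ++ U') by rewrite eW cat_subseq.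
have ht : h != t.
  apply/eqP => ht; case: (kept_alternate clK _ tK bK); first by rewrite eq_sym.
  by rewrite -{1}ht; sub_of achbt.
have ahtK : subseq [:: a; h; t] (kept S U' V2 c).
  rewrite subseq_filter /=; apply/andP; split; last by sub_of achbt.
  by move: aK hK tK; rewrite !mem_kept => /andP[-> _] /andP[-> _] /andP[-> _].
apply: (dead_ret h); last by rewrite /X eR'.
  split=> //; first by distinct.
  by apply: contra hV2 => /(chain_links_mem a t)/(mem_subseq sV).
Qed.

End Nested.

End Earliest.
End Step.

(** * Preliminary reductions and the induction *)

Section Final.
Variable T : eqType.
Implicit Types S R U V X : seq T.

Lemma earliest_last (p : pred T) R x : p x -> x \in R -> exists U V y,
  [/\ R = U ++ y :: V, p y, y \notin V &
      forall x, p x -> x \in R -> x != y -> x \in V].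
Proof.
move=> px; elim: R => // x0 R IH xR.
have [/andP[px0 x0R]|nx0] := boolP (p x0 && (x0 \notin R)).
  exists [::], R, x0; split=> // x' _; rewrite inE => /orP[/eqP->|//].
  by rewrite eqxx.
have x0R : p x0 -> x0 \in R by move=> px0; move: nx0; rewrite px0 negbK.
have xR' : x \in R.
  by move: xR; rewrite inE => /orP[/eqP e|//]; rewrite e x0R // -e.
have [U [V [y [eR py yV h]]]] := IH xR'.
exists (x0 :: U), V, y; split=> //; first by rewrite eR.
move=> x' px'; rewrite inE => /orP[/eqP e|]; last exact: h.
by apply: h => //; rewrite e; apply: x0R; rewrite -e.
Qed.

(** Everything can be pushed before anything is popped, so the colors are ranked in the reverse
    order of their first socks. *)
Lemma sortable_simple S R : clustered S -> (forall x, ~~ returning (S ++ R) x) ->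
  sortable S R.
Proof.
move=> clS nr; set X := S ++ R; have iN x : x \in X -> index x X < size X by rewrite index_mem.
have anti u v : u <> v -> subseq [:: u; v] X -> index u X < index v X.
  move=> /eqP uv sub; rewrite ltnNge; apply/negP => h.
  have vu : v != u by rewrite eq_sym.
  have vX : v \in X by apply: (mem_subseq sub); rewrite !inE eqxx orbT.
  apply: (returning_simple (nr v) vu); apply: (index_ltn_subseq (elimN eqP uv) _ sub).
  rewrite ltn_neqAle h andbT; apply: contra uv => /eqP e.
  have uX : u \in X by apply: (mem_subseq sub); rewrite mem_head.
  by rewrite -(nth_index u uX) -e nth_index.
exists (fun x => size X - index x X); split.
- move=> x y xX yX e; rewrite -(nth_index x xX) -[RHS](nth_index x yX); congr nth.
  by rewrite -[LHS](subKn (ltnW (iN x xX))) e subKn // ltnW // iN.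
- move=> u v sub uv; apply: ltn_sub2l; last apply: anti => //.
    by apply: iN; apply: (mem_subseq (s1 := [:: u; v])); rewrite ?mem_head //;
      exact: subseq_trans sub (prefix_subseq _ _).
  exact: subseq_trans sub (prefix_subseq _ _).
move=> u v w sub _ uv.
have sub2 : subseq [:: u; v] X by sub_of sub.
have /anti/(_ sub2) h : u <> v by move=> e; move: uv; rewrite e ltnn.
by move: (leq_sub2l (size X) (ltnW h)); rewrite leqNgt uv.
Qed.

Lemma sortable_drop S R q : q \notin R -> (forall v, q <> v -> ~~ subseq [:: q; v] S) ->
  sortable (filter (predC1 q) S) R -> sortable S R.
Proof.
move=> qR topq [r [rinj rdec r231]].
pose r' x := if x == q then 0 else (r x).+1.
have inF x : x \in S ++ R -> x != q -> x \in filter (predC1 q) S ++ R.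
  by rewrite !mem_cat mem_filter /= => + ->.
exists r'; split.
- move=> x y xX yX; rewrite /r'; case: eqP => [->|/eqP xq]; case: eqP => [->|/eqP yq] // [].
  by apply: rinj; exact: inF.
- move=> u v sub uv; rewrite /r'; have [uq|uq] := eqVneq u q.
    by move: (topq v) uv; rewrite -uq sub => h /h.
  have [//|vq] := eqVneq v q; rewrite ltnS; apply: rdec => //.
  by rewrite subseq_filter /= uq vq.
move=> u v w sub; rewrite /r'.
have [_|uq] := eqVneq u q; first by rewrite ltn0.
have [_|vq] := eqVneq v q; first by rewrite ltn0.
have [wq _|wq] := eqVneq w q; last first.
  rewrite !ltnS; apply: r231; have : subseq [:: u; v; w] (filter (predC1 q) (S ++ R)).
    by rewrite subseq_filter /= uq vq wq.
  by move/subseq_trans; apply; rewrite filter_cat cat_subseq // filter_subseq.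
rewrite ltnS => uv; have : r v < r u; last by move/(ltn_trans uv); rewrite ltnn.
apply: rdec; last by move=> e; move: uv; rewrite e ltnn.
rewrite subseq_filter /= uq vq /=.
move: sub; rewrite wq => /subseq_catP[k _ /andP[h1 h2]].
case: k h1 h2 => [|[|[|k]]] h1 h2.
- by case/negP: qR; apply: (mem_subseq h2); rewrite !inE eqxx !orbT.
- by case/negP: qR; apply: (mem_subseq h2); rewrite !inE eqxx !orbT.
- by case/negP: qR; apply: (mem_subseq h2); rewrite !inE eqxx.
by apply: subseq_trans h1; rewrite /= !eqxx ?sub0seq.
Qed.

(** Consecutive members of a forbidden triple differ, so it never needs both of two equal adjacent
    socks. *)
Lemma subseq_undouble (q : T) (s A B : seq T) : sorted (fun x y => x != y) s ->
  subseq s (A ++ q :: q :: B) -> subseq s (A ++ q :: B).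
Proof.
elim: A s => [|a A IH] [|x s] // srt; rewrite ?sub0seq //.
- case/subseq_consE => [[xq h]|//]; move: srt h; rewrite xq => srt h.
  apply: sub_cons; move: srt h.
  case: s => [|x' s]; first by move=> _ _; exact: sub0seq.
  by case/andP => qx' _; apply: subseq_cons_neq; rewrite eq_sym.
by rewrite /=; case: eqP => _; apply: IH => //; apply: path_sorted srt.
Qed.

Lemma sortable_merge S R q : sortable (rcons S q) R -> sortable (rcons S q) (q :: R).
Proof.
rewrite -cats1; case=> r [rinj rdec r231]; exists r; split=> //.
  move=> x y xX yX; apply: rinj; [move: xX|move: yX]; rewrite !mem_cat !inE;
  by case/orP => [/orP[]|/orP[]] ->; rewrite ?orbT.
move=> u v w sub wu uv; apply: (r231 u v w) => //.
rewrite -catA; apply: subseq_undouble; last by rewrite -catA in sub.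
rewrite /= andbT; apply/andP; split; apply/eqP => e; first by move: uv; rewrite e ltnn.
by move: (ltn_trans wu uv); rewrite e ltnn.
Qed.

Lemma last_pair (c e : T) V : c != e -> c \in V -> e \in V -> exists V1 V2,
  V = V1 ++ c :: V2 /\ c \notin V2 /\ e \in V2 \/
  V = V1 ++ e :: V2 /\ e \notin V2 /\ c \in V2.
Proof.
move=> ce cV eV; have [A [B [eAB cB]]] := last_occurrence cV.
have [eB|eB] := boolP (e \in B); first by exists A, B; left.
have [A' [B' [eA' eB']]] : exists A' B', A = A' ++ e :: B' /\ e \notin B'.
  apply: last_occurrence; move: eV; rewrite eAB mem_cat inE (negPf eB) orbF.
  by rewrite eq_sym (negPf ce) orbF.
exists A', (B' ++ c :: B); right; split; first by rewrite eAB eA' -catA.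
by rewrite mem_cat inE !negb_or eB' eq_sym ce eB mem_cat mem_head orbT.
Qed.

Lemma sortable_or_obs n S R : size S + size R <= n -> clustered S ->
  sortable S R \/ obs S R.
Proof.
elim: n S R => [|n IHn] S R hn clS.
  left; apply: sortable_simple => // x; move: hn; rewrite leqn0 addn_eq0 !size_eq0.
  by case/andP => /eqP-> /eqP->.
have IH S' R' : size S' + size R' < size S + size R ->
    clustered S' -> sortable S' R' \/ obs S' R'.
  by move=> h; apply: IHn; rewrite -ltnS; exact: leq_trans h hn.
have [/hasP[x xX xr]|/hasPn nr] := boolP (has (returning (S ++ R)) (S ++ R)); last first.
  left; apply: sortable_simple => // x; have [/nr //|xX] := boolP (x \in S ++ R).
  by apply: contra xX => /returningP[d _ /mem_subseq]; apply; exact: mem_head.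
(* A top that is absent from [R] is popped, and one that equals the next sock is merged with it.
   Otherwise the next sock separates the top from a later sock of its color, so the top is
   returning. *)
have [qtop|] : (S <> [::] -> exists2 q, top S q & returning (S ++ R) q) \/
    (sortable S R \/ obs S R); last by [].
  case/lastP: S hn clS IH xX xr => [|S q] hn clS IH xX xr; first by left.
  have tq := top_rcons clS; have qS : q \in rcons S q by case/andP: tq.
  have topq v : q <> v -> ~~ subseq [:: q; v] (rcons S q).
    by move=> /eqP qv; exact: (topP tq qv).
  have [qR|qR] := boolP (q \in R); last first.
    right; have szq : size (filter (predC1 q) (rcons S q)) < size (rcons S q).
      rewrite size_filter -(count_predC (predC1 q) (rcons S q)) -[X in X < _]addn0.
      by rewrite ltn_add2l -has_count; apply/hasP; exists q => //=; rewrite negbK.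
    have [||srt|ob] := IH (filter (predC1 q) (rcons S q)) R.
    - by rewrite ltn_add2r.
    - exact: clustered_subseq (filter_subseq _ _) clS.
    - by left; apply: sortable_drop srt.
    by right; apply: obs_subseq ob => //; exact: filter_subseq.
  case: R qR hn IH {xX xr} => // x0 R qR hn IH.
  have [xq|xq] := eqVneq x0 q.
    right; have [||srt|ob] := IH (rcons S q) R.
    - by rewrite /= addnS.
    - by [].
    - by left; rewrite xq; exact: sortable_merge.
    by right; apply: obs_subseq ob => //; exact: subseq_cons.
  left=> _; exists q => //; apply/returningP; exists x0; first by rewrite eq_sym.
  rewrite sub_head // sub_cons // sub1seq.
  by move: qR; rewrite inE eq_sym (negPf xq).
have [y' [y'R y'r]] : exists y', y' \in R /\ returning (S ++ R) y'.
  exists x; split=> //; have [d xd sub] := returningP _ _ xr.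
  case/subseq_catP: sub => k _ /andP[h1 h2].
  case: k h1 h2 => [|[|[|k]]] h1 h2; try by apply: (mem_subseq h2); rewrite !inE eqxx ?orbT.
  case: (clustered_subseqF clS xd); apply: subseq_trans h1.
  by rewrite /= !eqxx ?sub0seq.
have [U [V [y [eR yr yV oth]]]] := earliest_last y'r y'R.
have others z : returning (S ++ R) z -> z != y -> z \in V.
  move=> zr zy; apply: oth => //; have [d zd sub] := returningP _ _ zr.
  case/subseq_catP: sub => k _ /andP[h1 h2].
  case: k h1 h2 => [|[|[|k]]] h1 h2; try by apply: (mem_subseq h2); rewrite !inE eqxx ?orbT.
  case: (clustered_subseqF clS zd); apply: subseq_trans h1.
  by rewrite /= !eqxx ?sub0seq.
have [topy|[yS ntop]] : (y \in S -> top S y) \/ (y \in S /\ ~~ top S y).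
  have [yS|yS] := boolP (y \in S); last by left.
  by have [ty|nt] := boolP (top S y); [left|right].
  2: exact: (case_buried clS qtop IH eR yV others yS ntop).
have [clK|ncl] := boolP (clustered (kept S U V y)).
  exact: (case_sorted qtop IH eR yV yr others topy clK).
have [|[c [e [cr ce cy ey why]]]] := unclustered_reason clS qtop eR yV topy ncl; first by right.
have cV := others c cr cy.
have cec : subseq [:: c; e; c] (S ++ U) by case: why => [[]//|h]; sub_of h.
(* If [e] returns too, the one of [c] and [e] that runs out first is output next; if [e] is simple,
   it is [c]. *)
have [er|er] := boolP (returning (S ++ R) e).
  have [V1 [V2 [[eV [h1 h2]]|[eV [h1 h2]]]]] := last_pair ce cV (others e er ey).
    exact: (@case_crossing _ _ _ clS qtop IH _ _ _ eR others c e V1 V2 true).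
  apply: (@case_crossing _ _ _ clS qtop IH _ _ _ eR others e c V1 V2 false) => //.
  by rewrite eq_sym.
have [V1 [V2 [eV cV2]]] := last_occurrence cV.
apply: (case_nested clS qtop IH eR yV yr others ce cy ey cr er eV cV2 topy).
by case: why => // -[]; rewrite (negPf er).
Qed.

End Final.

Theorem theorem1p1 (T : eqType) (X : seq T) (hX : ~ foot_sortable X) :
  exists2 Z : seq T, subseq Z X & Gamma Z.
Proof.
have [//|srt|ob] := @sortable_or_obs T _ [::] X (leqnn _).
  by case: hX; exact: foot_sortable_rank.
exact: obs_nil ob.
Qed.
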